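(* Let $\Omega\subset\mathbb R^n$ be a bounded domain with Lipschitz boundary, $m>1+\frac n2$ an integer, $C\ge1$ an integer, $v\in L^2((0,1),H^m(\Omega,\mathbb R^n)\cap H^1_0(\Omega,\mathbb R^n))$ with flow $Y$, and $I\in L^2((0,1),L^2(\Omega,\mathbb R^C))$ an image path (given at every time $t\in[0,1]$). Consider the conditions, required for all $t<s$ in $[0,1]$ (and a.e. point of $\Omega$), $$\text{(a)}\quad I(t,Y(t,\cdot))-I(s,Y(s,\cdot))=\int_t^sZ(r,Y(r,\cdot))\,dr,\qquad Z\in L^2((0,1),L^2(\Omega,\mathbb R^C)),$$ $$\text{(b)}\quad \|I(t,Y(t,\cdot))-I(s,Y(s,\cdot))\|\le\int_t^sz(r,Y(r,\cdot))\,dr,\qquad z\in L^2((0,1),L^2(\Omega)).$$ Then for every $z$ satisfying (b) there exists a $Z$ satisfying (a) with $z\ge\|Z\|$ a.e. in $(0,1)\times\Omega$. Conversely, for every $Z$ satisfying (a) there exists a $z$ satisfying (b) with $z=\|Z\|$.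
   Context: The flow $Y$ of $v$ is the solution of $\frac{d}{dt}Y(t,x)=v(t,Y(t,x))$ for a.e. $t\in[0,1]$, $Y(0,x)=x$, $x\in\Omega$; for each $t$ the map $Y(t,\cdot)$ is a diffeomorphism of $\overline\Omega$. $\|\cdot\|$ is the Euclidean norm on $\mathbb R^C$, taken pointwise. *)

(* Defs.v *)
(* MathComp-Analysis; R is an arbitrary realType and R^n is 'rV[R]_n. *)
From HB Require Import structures.
From mathcomp Require Import all_boot all_order all_algebra.
From mathcomp Require Import all_classical all_reals all_analysis.

Set Implicit Arguments.
Unset Strict Implicit.
Unset Printing Implicit Defensive.

Import Order.TTheory GRing.Theory Num.Theory.
Import numFieldNormedType.Exports.

Local Open Scope classical_set_scope.
Local Open Scope ring_scope.

Definition rV_display : measure_display.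
Proof. exact. Qed.

(* The sigma-algebra generated by the coordinates, i.e. the Borel one. *)
Section measurable_rV.
Context {R : realType} {n : nat}.

Let coord_rV : 'I_n -> 'rV[R]_n -> measurableTypeR R := fun i x => x 0 i.

Let rV_set0 : g_sigma_preimage coord_rV set0.
Proof. exact: sigma_algebra0. Qed.

Let rV_setC A : g_sigma_preimage coord_rV A -> g_sigma_preimage coord_rV (~` A).
Proof. exact: sigma_algebraC. Qed.

Let rV_bigcup (F : _^nat) : (forall i, g_sigma_preimage coord_rV (F i)) ->
  g_sigma_preimage coord_rV (\bigcup_i F i).
Proof. exact: sigma_algebra_bigcup. Qed.

HB.instance Definition _ := @isMeasurable.Build rV_display
  'rV[R]_n (g_sigma_preimage coord_rV) rV_set0 rV_setC rV_bigcup.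

End measurable_rV.

Lemma measurable_coord_rV (R : realType) (n : nat) (i : 'I_n) :
  measurable_fun [set: 'rV[R]_n] (fun x => x 0 i : measurableTypeR R).
Proof.
move=> _ B mB; apply: sub_sigma_algebra.
by rewrite (bigD1 i)//=; left; exists B.
Qed.

Lemma measurable_fun_rV d (T : measurableType d) (R : realType) (n : nat)
    (f : T -> 'rV[R]_n) :
  (forall i, measurable_fun [set: T] (fun t => f t 0 i : measurableTypeR R)) ->
  measurable_fun [set: T] f.
Proof.
move=> mf; apply: (@measurability _ _ _ _ _ _
  (\big[setU/set0]_(i < n) preimage_set_system setT
     (fun x : 'rV[R]_n => x 0 i : measurableTypeR R) measurable)) => //.
move=> _ [A + <-]; rewrite setTI; elim/big_ind : _ => //.
- by move=> P Q PA QA [/PA|/QA].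
- move=> i _ [B mB <-]; rewrite setTI -[X in measurable X]setTI.
  exact: mf.
Qed.

Definition cons_rV (R : realType) (n : nat) (p : measurableTypeR R * 'rV[R]_n) :
  'rV[R]_n.+1 := row_mx (p.1%:M : 'M[R]_1) p.2.

Definition uncons_rV (R : realType) (n : nat) (x : 'rV[R]_n.+1) :
  measurableTypeR R * 'rV[R]_n :=
  (x 0 ord0, rsubmx (x : 'rV[R]_(1 + n))).

Lemma cons_rVK (R : realType) (n : nat) : cancel (@cons_rV R n) (@uncons_rV R n).
Proof.
move=> [a x]; rewrite /uncons_rV /cons_rV row_mxKr; congr pair.
by rewrite mxE; case: splitP => //= j _; rewrite mxE (ord1 j).
Qed.

Lemma measurable_cons_rV (R : realType) (n : nat) :
  measurable_fun setT (@cons_rV R n).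
Proof.
apply: measurable_fun_rV => i.
have E (p : measurableTypeR R * 'rV[R]_n) : cons_rV p 0 i =
    match fintype.split (i : 'I_(1 + n)) with inl _ => p.1 | inr j => p.2 0 j end.
  by rewrite mxE; case: (fintype.split _) => //= j; rewrite mxE (ord1 j).
rewrite (funext E); case: (fintype.split _) => [_|j]; first exact: measurable_fst.
exact: (measurableT_comp (measurable_coord_rV j) measurable_snd).
Qed.

Lemma measurable_uncons_rV (R : realType) (n : nat) :
  measurable_fun setT (@uncons_rV R n).
Proof.
apply: measurable_fun_pair; first exact: measurable_coord_rV.
apply: measurable_fun_rV => i.
apply: (eq_measurable_fun (fun x : 'rV[R]_n.+1 => x 0 (rshift 1 i))).
  by move=> x _; rewrite mxE.
exact: measurable_coord_rV.
Qed.

(* Lebesgue measure on R^(n+1), from lambda on R and mu on R^n *)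
Section cons_measure.
Context {R : realType} {n : nat}.
Variable mu : {sigma_finite_measure set 'rV[R]_n -> \bar R}.

Definition cons_measure : set 'rV[R]_n.+1 -> \bar R :=
  pushforward (lebesgue_measure \x mu)%E (@cons_rV R n).

Let cons_measure0 : cons_measure set0 = 0%E.
Proof. by rewrite /cons_measure /pushforward preimage_set0 measure0. Qed.

Let cons_measure_ge0 A : (0 <= cons_measure A)%E.
Proof. exact: (@measure_ge0 _ _ _ (lebesgue_measure \x mu)%E). Qed.

Let cons_measure_sigma_additive : semi_sigma_additive cons_measure.
Proof.
move=> F mF tF mUF; rewrite /cons_measure /pushforward preimage_bigcup.
have mcons A : measurable A -> measurable (@cons_rV R n @^-1` A).
  by move=> mA; rewrite -[X in measurable X]setTI; exact: measurable_cons_rV.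
apply: measure_semi_sigma_additive.
- by move=> k; exact: mcons.
- apply/trivIsetP => /= i j _ _ ij; rewrite -preimage_setI.
  by move/trivIsetP : tF => /(_ _ _ _ _ ij) ->//; rewrite preimage_set0.
- by rewrite -preimage_bigcup; exact: mcons.
Qed.

HB.instance Definition _ := isMeasure.Build _ _ _ cons_measure
  cons_measure0 cons_measure_ge0 cons_measure_sigma_additive.

Let cons_measure_sigma_finite : sigma_finite setT cons_measure.
Proof.
have /sigma_finiteP[F [TF ndF Foo]] :=
  sigma_finiteT (@lebesgue_measure R : {sigma_finite_measure set _ -> \bar R}).
have /sigma_finiteP[G [TG ndG Goo]] := sigma_finiteT mu.
exists (fun k => @uncons_rV R n @^-1` (F k `*` G k)).
  rewrite -preimage_bigcup -[LHS](preimage_setT (@uncons_rV R n)).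
  congr (_ @^-1` _); rewrite -setXTT TF TG predeqE => -[x y]; split.
    move=> [/= [i _ Fix] [j _ Gjy]]; exists (maxn i j) => //; split.
    - by move: x Fix; exact/subsetPset/ndF/leq_maxl.
    - by move: y Gjy; exact/subsetPset/ndG/leq_maxr.
  by move=> [i _ []/= ? ?]; split; exists i.
move=> k; have [mF Fk] := Foo k; have [mG Gk] := Goo k; split.
  rewrite -[X in measurable X]setTI; apply: measurable_uncons_rV => //.
  exact: measurableX.
rewrite /cons_measure /pushforward -comp_preimage.
rewrite (_ : _ \o _ = id) ?preimage_id; last first.
  by apply/funext => p; exact: cons_rVK.
by rewrite product_measure1E// lte_mul_pinfty// ge0_fin_numE.
Qed.

HB.instance Definition _ := Measure_isSigmaFinite.Build _ _ _ cons_measure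
  cons_measure_sigma_finite.

End cons_measure.

(* On R^0, a point, Lebesgue measure is the unit mass. *)
Fixpoint lebesgue_rV (R : realType) (n : nat) :
    {sigma_finite_measure set 'rV[R]_n -> \bar R} :=
  match n return {sigma_finite_measure set 'rV[R]_n -> \bar R} with
  | 0 => dirac (0 : 'rV[R]_0)
  | n'.+1 => cons_measure (lebesgue_rV R n')
  end.

(* 'rV[R]_n is normed by the library with the maximum norm; this is the
   Euclidean one. *)
Definition eucl_norm (R : realType) (k : nat) (x : 'rV[R]_k) : R :=
  Num.sqrt (\sum_i x 0 i ^+ 2).

Section domains.
Context {R : realType} {n : nat}.
Implicit Type Om : set 'rV[R]_n.

(* Near each boundary point, in suitable orthonormal coordinates x *m Q, Om is
   the strict epigraph over the i-th axis of a Lipschitz function of the other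
   n - 1 coordinates. *)
Definition lipschitz_boundary Om : Prop :=
  forall x0, closure Om x0 -> ~ interior Om x0 ->
  exists (r : R) (Q : 'M[R]_n) (i : 'I_n) (gamma : 'rV[R]_n.-1 -> R) (L : R),
    [/\ 0 < r, Q *m Q^T = 1%:M,
        forall a b, `|gamma a - gamma b| <= L * `|a - b| &
        forall x, ball x0 r x ->
          (Om x <-> gamma (col' i (x *m Q)) < (x *m Q) 0 i)].

Definition bounded_lipschitz_domain Om : Prop :=
  [/\ Om !=set0, open Om, connected Om, bounded_set Om & lipschitz_boundary Om].

Definition C1_closure Om (f : 'rV[R]_n -> 'rV[R]_n) : Prop :=
  {within closure Om, continuous f} /\
  exists G : 'rV[R]_n -> 'M[R]_n, {within closure Om, continuous G} /\
    forall x, Om x -> differentiable f x /\ 'J f x = G x.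

(* A diffeomorphism of the closure of Om: a bijection of the closure that
   preserves Om, of class C^1 up to the boundary together with its inverse. *)
Definition diffeo_closure Om (f : 'rV[R]_n -> 'rV[R]_n) : Prop :=
  exists g : 'rV[R]_n -> 'rV[R]_n,
    [/\ C1_closure Om f, C1_closure Om g,
        forall x, Om x -> Om (f x) /\ Om (g x),
        forall x, closure Om x -> closure Om (f x) /\ closure Om (g x) &
        forall x, closure Om x -> g (f x) = x /\ f (g x) = x].

End domains.

Section sobolev.
Context {R : realType} {n : nat}.
Implicit Types (Om : set 'rV[R]_n) (u phi : 'rV[R]_n -> R).

Local Notation lambda := (lebesgue_rV R n).

Definition partial (i : 'I_n) phi : 'rV[R]_n -> R :=
  fun x => 'D_(delta_mx 0 i) phi x.

Definition partials (s : seq 'I_n) phi : 'rV[R]_n -> R := foldr partial phi s.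

Definition smooth phi : Prop := forall s : seq 'I_n,
  continuous (partials s phi) /\
  forall x i, derivable (partials s phi) x (delta_mx 0 i).

Definition test_function Om phi : Prop :=
  smooth phi /\
  exists K : set 'rV[R]_n,
    [/\ compact K, K `<=` Om & forall x, ~ K x -> phi x = 0].

(* Square-integrable functions; as everywhere below, an element of an L^2 space
   is given by a Borel representative. *)
Definition L2 Om u : Prop :=
  measurable_fun Om u /\ (\int[lambda]_(x in Om) ((u x) ^+ 2)%:E < +oo)%E.

(* Multi-indices of order at most m. *)
Definition multi_index (m : nat) : predArgType := {ffun 'I_n -> 'I_m.+1}.

Definition mi_order m (a : multi_index m) : nat := (\sum_i (a i : nat))%N.

Definition mpartial m (a : multi_index m) : ('rV[R]_n -> R) -> 'rV[R]_n -> R :=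
  partials (flatten [seq nseq (a i) i | i <- enum 'I_n]).

Definition weak_derivative Om m (a : multi_index m) u (g : 'rV[R]_n -> R) : Prop :=
  forall phi, test_function Om phi ->
    \int[lambda]_(x in Om) (u x * mpartial a phi x) =
    (-1) ^+ mi_order a * \int[lambda]_(x in Om) (g x * phi x).

Definition weak_derivatives Om m u (g : multi_index m -> 'rV[R]_n -> R) : Prop :=
  L2 Om u /\
  forall a : multi_index m, (mi_order a <= m)%N ->
    L2 Om (g a) /\ weak_derivative Om a u (g a).

Definition sobolev_H Om (m : nat) u : Prop := exists g, @weak_derivatives Om m u g.

(* The square of the H^m norm, +oo outside H^m. Weak derivatives are unique up
   to null sets, so on H^m the infimum is over a singleton. *)
Definition sobolev_norm2 Om (m : nat) u : \bar R :=
  ereal_inf [set (\sum_(a : multi_index m | (mi_order a <= m)%N)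
                   \int[lambda]_(x in Om) ((g a x) ^+ 2)%:E)%E
            | g in @weak_derivatives Om m u].

Definition sobolev_H10 Om u : Prop :=
  sobolev_H Om 1 u /\
  forall e : R, 0 < e -> exists2 phi, test_function Om phi &
    (sobolev_norm2 Om 1 (fun x => (u x - phi x)%R) < e%:E)%E.

End sobolev.

Section paths.
Context {R : realType} {n : nat}.
Variable Om : set 'rV[R]_n.

Local Notation lambda1 := (@lebesgue_measure R).
Local Notation lambda := (lebesgue_rV R n).

(* H^m(Om, R^n) \cap H^1_0(Om, R^n), with the squared norm of H^m(Om, R^n) *)
Definition velocity_space (m : nat) (w : 'rV[R]_n -> 'rV[R]_n) : Prop :=
  forall j, sobolev_H Om m (fun x => w x 0 j) /\
            sobolev_H10 Om (fun x => w x 0 j).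

Definition velocity_norm2 (m : nat) (w : 'rV[R]_n -> 'rV[R]_n) : \bar R :=
  (\sum_j sobolev_norm2 Om m (fun x => (w x 0 j)%R))%E.

Definition simple_velocity (m : nat) (s : R -> 'rV[R]_n -> 'rV[R]_n) : Prop :=
  exists (p : nat) (A : 'I_p -> set R) (w : 'I_p -> 'rV[R]_n -> 'rV[R]_n),
    (forall i, measurable (A i : set (measurableTypeR R)) /\
               velocity_space m (w i)) /\
    forall t x, s t x = \sum_i \1_(A i) t *: w i x.

(* The Bochner space L^2((0,1), H^m \cap H^1_0): a.e. limits of simple
   functions, with square-integrable norm. *)
Definition L2_velocity (m : nat) (v : R -> 'rV[R]_n -> 'rV[R]_n) : Prop :=
  [/\ {ae lambda1, forall t, t \in `]0, 1[ -> velocity_space m (v t)},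
      exists s : nat -> R -> 'rV[R]_n -> 'rV[R]_n,
        (forall k, simple_velocity m (s k)) /\
        {ae lambda1, forall t, t \in `]0, 1[ ->
          velocity_norm2 m (fun x => v t x - s k t x) @[k --> \oo] --> 0%E} &
      (\int[lambda1]_(t in `]0%R, 1%R[) velocity_norm2 m (v t) < +oo)%E].

Definition absolutely_continuous01 k (f : R -> 'rV[R]_k) : Prop :=
  forall e : R, 0 < e -> exists2 d : R, 0 < d &
  forall (p : nat) (a b : 'I_p -> R),
    (forall i, [/\ 0 <= a i, a i <= b i & b i <= 1]) ->
    trivIset [set: 'I_p] (fun i => `]a i, b i[%classic) ->
    \sum_i (b i - a i) < d -> \sum_i eucl_norm (f (b i) - f (a i)) < e.

(* Y is the flow of v. The equation evaluates v pointwise: v t is the continuous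
   representative, which exists as m > 1 + n/2. A solution is absolutely
   continuous in t, and each Y t is a diffeomorphism of the closure of Om. *)
Definition flow_of (v Y : R -> 'rV[R]_n -> 'rV[R]_n) : Prop :=
  [/\ {ae lambda1, forall t, t \in `]0, 1[ -> {within closure Om, continuous (v t)}},
      forall x, Om x ->
        [/\ Y 0 x = x,
            absolutely_continuous01 (fun t => Y t x) &
            {ae lambda1, forall t : R, t \in `]0, 1[ ->
              is_derive t 1 (fun s : R => Y s x) (v t (Y t x))}] &
      forall t, t \in `[0, 1] -> diffeo_closure Om (Y t)].

(* L^2((0,1), L^2(Om)), identified with L^2((0,1) x Om) *)
Definition L2_path (z : R * 'rV[R]_n -> R) : Prop :=
  let D := [set` `]0%R, 1%R[] `*` Om : set (measurableTypeR R * 'rV[R]_n) in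
  measurable_fun D z /\
  (\int[(lambda1 \x lambda)%E]_(p in D) ((z p) ^+ 2)%:E < +oo)%E.

Definition L2_vpath k (Z : R * 'rV[R]_n -> 'rV[R]_k) : Prop :=
  forall j, L2_path (fun p => Z p 0 j).

(* An element of L^2((0,1), L^2(Om, R^k)) that is given at every time in [0,1]
   as an element of L^2(Om, R^k). *)
Definition image_path k (I : R -> 'rV[R]_n -> 'rV[R]_k) : Prop :=
  (forall t, t \in `[0, 1] -> forall j, L2 Om (fun x => I t x 0 j)) /\
  exists2 J : R * 'rV[R]_n -> 'rV[R]_k, L2_vpath J &
    {ae lambda1, forall t, t \in `]0, 1[ ->
      {ae lambda, forall x, Om x -> I t x = J (t, x)}}.

(* Here and below, the condition includes that the integral over r exists. *)
Definition transport_eq k (Y : R -> 'rV[R]_n -> 'rV[R]_n)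
    (I : R -> 'rV[R]_n -> 'rV[R]_k) (Z : R * 'rV[R]_n -> 'rV[R]_k) : Prop :=
  forall t s, 0 <= t -> t < s -> s <= 1 ->
    {ae lambda, forall x, Om x ->
      (forall j, lambda1.-integrable `]t, s[ (fun r => (Z (r, Y r x) 0 j)%:E)) /\
      I t (Y t x) - I s (Y s x) =
        \row_j \int[lambda1]_(r in `]t, s[) (Z (r, Y r x) 0 j)}.

Definition transport_le k (Y : R -> 'rV[R]_n -> 'rV[R]_n)
    (I : R -> 'rV[R]_n -> 'rV[R]_k) (z : R * 'rV[R]_n -> R) : Prop :=
  forall t s, 0 <= t -> t < s -> s <= 1 ->
    {ae lambda, forall x, Om x ->
      lambda1.-integrable `]t, s[ (fun r => (z (r, Y r x))%:E) /\
      eucl_norm (I t (Y t x) - I s (Y s x)) <=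
        \int[lambda1]_(r in `]t, s[) (z (r, Y r x))}.

End paths.

(* Main.v *)
Require Import Defs.
From HB Require Import structures.
From mathcomp Require Import all_boot all_order all_algebra.
From mathcomp Require Import all_classical all_reals all_analysis.
From mathcomp Require Import measurable_realfun ring lra.
Import Order.TTheory GRing.Theory Num.Theory.
Import numFieldNormedType.Exports.
Local Open Scope classical_set_scope.
Local Open Scope ring_scope.

Set Implicit Arguments.
Unset Strict Implicit.
Unset Printing Implicit Defensive.

(* For almost every x, inequality (b) holds simultaneously for all times of a
   countable dense grid, so t |-> I(t, Y(t,x)) is absolutely continuous on the
   grid, dominated by r |-> z(r, Y(r,x)). By Radon-Nikodym it has a density, which
   by Lebesgue differentiation is the limit W(r,x) of difference quotients; hence
   W is jointly measurable and |W(r,x)| <= z(r, Y(r,x)). Put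
   Z(r,y) = W(r, Y(r,.)^-1(y)). The set where |Z| > z pulls back under
   (r,x) |-> (r, Y(r,x)) to a null set, and it is null itself, since by Fubini
   almost all its time slices are images of null sets under the differentiable
   maps Y(r,.). The converse is the norm inequality for integrals. *)

(** * Densities of paths controlled on a grid of times *)

(** Inequality (b) holds for each pair of times outside a null set that depends on the pair, so
    along a single trajectory nothing is known at all times at once, whereas one density must serve
    all pairs. This is why [W] is built from difference quotients at grid times only: it does not
    depend on the pair. For a given pair (t, s) the argument is rerun on the grid enlarged by t and
    s, and gives (a) with the same [W]. The quotients also settle measurability, since each involves
    [I] at finitely many times; Radon-Nikodym, applied to each trajectory separately, says nothing
    about the dependence on x. Norms of vector quotients are compared with averages of z before the
    limit is taken, which gives the bound by z with constant 1; bounding the components one by one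
    would lose a factor depending on C. The maps Y(t,.) come with no bound on their derivatives that
    is uniform in t, hence the null set argument at fixed times, slice by slice. *)

Section grid.
Context {R : realType}.
Implicit Types (k : nat) (t : R).

(* The endpoints of the cell of the grid of mesh 1/(k+1) that contains t; the
   right endpoint is never t itself. *)
Definition grid_lo k t : R := (Num.floor (t * k.+1%:R))%:~R / k.+1%:R.
Definition grid_hi k t : R := (Num.floor (t * k.+1%:R) + 1)%:~R / k.+1%:R.

Lemma grid_hiE k t : grid_hi k t = grid_lo k t + k.+1%:R^-1.
Proof. by rewrite /grid_hi intrD mulrDl mul1r. Qed.

Lemma grid_lo_le k t : grid_lo k t <= t.
Proof. by rewrite ler_pdivrMr// floor_le. Qed.

Lemma lt_grid_hi k t : t < grid_hi k t.
Proof. by rewrite ltr_pdivlMr// floorD1_gt. Qed.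

Lemma grid_hi_le k t : grid_hi k t <= t + k.+1%:R^-1.
Proof. by rewrite grid_hiE lerD2r grid_lo_le. Qed.

Lemma le_grid_hi k s t : s <= t -> grid_hi k s <= grid_hi k t.
Proof.
by move=> st; rewrite ler_pM2r// ler_int lerD2r le_floor// ler_pM2r.
Qed.

Lemma grid_lo_ge0 k t : 0 <= t -> 0 <= grid_lo k t.
Proof. by move=> t0; rewrite divr_ge0// ler0z floor_ge0 mulr_ge0. Qed.

Lemma grid_hi_le1 k t : t < 1 -> grid_hi k t <= 1.
Proof.
move=> t1; rewrite ler_pdivrMr// mul1r -[leRHS]/(k.+1%:R) pmulrn ler_int lezD1.
by rewrite -(ltr_int R) -pmulrn (le_lt_trans (floor_le _))// gtr_pMl.
Qed.

Lemma cvg_grid_hi t : grid_hi k t @[k --> \oo] --> t.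
Proof.
apply: (@squeeze_cvgr _ _ _ _ (cst t) (fun k => t + k.+1%:R^-1)).
- by near=> k; rewrite /cst (ltW (lt_grid_hi _ _)) grid_hi_le.
- exact: cvg_cst.
- by rewrite -[X in _ --> X]addr0; apply: cvgD; [exact: cvg_cst|exact: cvg_harmonic].
Unshelve. all: by end_near. Qed.

End grid.

Section primitive.
Context {R : realType} (g : R -> R).
Local Notation mu := (@lebesgue_measure R).
Hypothesis intg : mu.-integrable setT (EFin \o g).

Definition norm_primitive (t : R) : R := \int[mu]_(x in `]-oo, t]) `|g x|.
Local Notation G := norm_primitive.

Let intng (A : set R) : measurable A -> mu.-integrable A (EFin \o (fun x => `|g x|)).
Proof.
move=> mA; apply: integrableS (integrable_abse intg) => //.
Qed.

Lemma norm_primitiveB (a b : R) : a <= b ->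
  G b - G a = \int[mu]_(x in `]a, b]) `|g x|.
Proof.
move=> ab; apply: Rintegral_itvB => //; exact: intng.
Qed.

Lemma le_norm_primitive (a b : R) : a <= b -> G a <= G b.
Proof.
by move=> ab; rewrite -subr_ge0 norm_primitiveB//; apply: Rintegral_ge0.
Qed.

(** Absolute continuity of the integral: an increment is the integral of |g| over an interval, hence
    small together with its length. *)
Lemma continuous_norm_primitive : continuous G.
Proof.
move=> t; apply/cvgrPdist_lt => e e0.
have [d [d0 dP]] := integral_normr_continuous intg e0.
have H (a b : R) : a <= b -> b - a < d -> `|G b - G a| < e.
  move=> ab abd; rewrite norm_primitiveB// ger0_norm; last exact: Rintegral_ge0.
  suff muab : (mu `]a, b]%classic < d%:E)%E by exact: (dP _ (measurable_itv _)).
  rewrite lebesgue_measure_itv/= lte_fin; case: ifP => _; last by rewrite lte_fin.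
  by rewrite -EFinB lte_fin.
apply/nbhs_ballP; exists d => //= s; rewrite /ball/= => tsd.
have [st|ts] := leP s t.
  by apply: H => //; apply: le_lt_trans tsd; exact: ler_norm.
have := H t s (ltW ts); rewrite -normrN opprB; apply.
by apply: le_lt_trans tsd; rewrite -normrN opprB ler_norm.
Qed.

End primitive.

(** The union of the grids of all meshes, that is, the rationals, in the form in which [grid_lo] and
    [grid_hi] produce them. *)
Definition is_grid {R : realType} (x : R) :=
  exists (k : nat) (i : int), x = i%:~R / k.+1%:R.

Section grid_extension.
Context {R : realType} (G f : R -> R).
Hypothesis cG : continuous G.
Hypothesis fG : forall a b, is_grid a -> is_grid b -> a <= b ->
  `|f b - f a| <= G b - G a.

(** Only the values of [f] at grid points enter, so [f] may be arbitrary elsewhere; the sequence is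
    Cauchy because [G] is continuous. *)
Definition grid_ext (t : R) : R := lim (f (grid_hi k t) @[k --> \oo]).
Local Notation F := grid_ext.

Lemma is_grid_hi k (t : R) : is_grid (grid_hi k t).
Proof. by exists k, (Num.floor (t * k.+1%:R) + 1). Qed.

Let fG2 a b : is_grid a -> is_grid b -> `|f b - f a| <= `|G b - G a|.
Proof.
move=> ga gb; have [ab|/ltW ba] := leP a b.
  by rewrite (le_trans (fG ga gb ab))// ler_norm.
by rewrite distrC [leRHS]distrC (le_trans (fG gb ga ba))// ler_norm.
Qed.

Let cvgG t : G (grid_hi k t) @[k --> \oo] --> G t.
Proof. by apply: continuous_cvg; [exact: cG|exact: cvg_grid_hi]. Qed.

Lemma cvg_grid_ext t : f (grid_hi k t) @[k --> \oo] --> F t.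
Proof.
apply/cauchy_cvgP/cauchy_exP => e e0.
have e20 : 0 < e / 2 by rewrite divr_gt0.
have /cvgrPdist_lt/(_ _ e20)[N _ HN] := @cvgG t.
exists (f (grid_hi N t)); exists N => // k Nk; rewrite /ball/=.
apply: (le_lt_trans (fG2 (is_grid_hi k t) (is_grid_hi N t))).
rewrite (splitr e) -(subrKA (G t)) (le_lt_trans (ler_normD _ _))// ltrD//.
  by rewrite distrC; apply: HN => /=.
exact: HN.
Qed.

Lemma grid_extB s t : s <= t -> `|F t - F s| <= G t - G s.
Proof.
move=> st.
have c1 : `|f (grid_hi k t) - f (grid_hi k s)| @[k --> \oo] --> `|F t - F s|.
  by apply: cvg_norm; apply: cvgB; exact: cvg_grid_ext.
have c2 : G (grid_hi k t) - G (grid_hi k s) @[k --> \oo] --> G t - G s.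
  by apply: cvgB; exact: cvgG.
apply: (ler_cvg_to c1 c2); near=> k.
by apply: fG; [exact: is_grid_hi..|exact: le_grid_hi].
Unshelve. all: by end_near. Qed.

(** Since [grid_hi k d] is never [d] itself, this is continuity of [f] along the grid, forced by
    that of [G]. *)
Lemma grid_extE d : is_grid d -> F d = f d.
Proof.
move=> gd; apply: (cvg_unique _ (@cvg_grid_ext d)) => //.
apply/cvgrPdist_lt => e e0.
have /cvgrPdist_lt/(_ _ e0) := @cvgG d.
apply: filterS => k; apply: le_lt_trans.
by apply: fG2 => //; exact: is_grid_hi.
Qed.

Lemma continuous_grid_ext : continuous F.
Proof.
move=> t; apply/cvgrPdist_lt => e e0.
have /cvgrPdist_lt/(_ _ e0) := @cG t.
apply: filterS => s; apply: le_lt_trans; have [st|/ltW st] := leP s t.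
  by rewrite (le_trans (grid_extB st))// ler_norm.
by rewrite distrC [leRHS]distrC (le_trans (grid_extB st))// ler_norm.
Qed.

End grid_extension.

(* With G a primitive of |g|, the functions G + f and G - f extend to continuous
   nondecreasing functions; their Stieltjes measures add up to 2|g| times
   Lebesgue measure, so both are absolutely continuous, and Radon-Nikodym
   applies. *)
Lemma grid_density {R : realType} (g f : R -> R) :
  lebesgue_measure.-integrable setT (EFin \o g) ->
  (forall a b, is_grid a -> is_grid b -> a <= b ->
     `|f b - f a| <= \int[lebesgue_measure]_(x in `]a, b]) `|g x|) ->
  exists2 w : R -> R, lebesgue_measure.-integrable setT (EFin \o w) &
    forall a b, is_grid a -> is_grid b -> a <= b ->
      f b - f a = \int[lebesgue_measure]_(x in `]a, b]) w x.
Proof.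
set mu := lebesgue_measure => ig fg.
pose G := norm_primitive g.
have cG : continuous G by exact: continuous_norm_primitive.
have fG a b : is_grid a -> is_grid b -> a <= b -> `|f b - f a| <= G b - G a.
  by move=> ga gb ab; rewrite norm_primitiveB//; exact: fg.
pose F := grid_ext f.
have cF : continuous F by exact: (continuous_grid_ext cG fG).
have FB s t : s <= t -> `|F t - F s| <= G t - G s.
  by move=> st; exact: (grid_extB cG fG st).
have ndP : nondecreasing (G \+ F).
  move=> s t st /=; have := FB s t st; rewrite ler_norml => /andP[+ _]; lra.
have ndM : nondecreasing (G \- F).
  move=> s t st /=; have := FB s t st; rewrite ler_norml => /andP[_]; lra.
have ndG : nondecreasing (G \+ G).
  by move=> s t st /=; rewrite lerD// le_norm_primitive.
have cP : continuous (G \+ F) by move=> x; apply: cvgD; [exact: cG|exact: cF].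
have cM : continuous (G \- F) by move=> x; apply: cvgB; [exact: cG|exact: cF].
have cGG : continuous (G \+ G) by move=> x; apply: cvgD; exact: cG.
pose P : cumulative R R := HB.pack_for (cumulative R R) (G \+ F)
  (isCumulative.Build R _ R (G \+ F) ndP (right_continuousW cP)).
pose M : cumulative R R := HB.pack_for (cumulative R R) (G \- F)
  (isCumulative.Build R _ R (G \- F) ndM (right_continuousW cM)).
pose D : cumulative R R := HB.pack_for (cumulative R R) (G \+ G)
  (isCumulative.Build R _ R (G \+ G) ndG (right_continuousW cGG)).
have lsmE (h : cumulative R R) a b : a <= b ->
    lebesgue_stieltjes_measure h `]a, b]%classic = (h b - h a)%:E.
  move=> ab.
  rewrite /lebesgue_stieltjes_measure /measure_extension/= measurable_mu_extE/=.
    by rewrite wlength_itv_bnd.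
  exact: is_ocitv.
have m_g A : measurable A -> mu.-integrable A (fun x => (`|g x| + `|g x|)%:E).
  move=> mA; apply: (@integrableS _ _ _ mu setT) => //.
  have -> : (fun x => (`|g x| + `|g x|)%:E) =
      ((fun x => `|(g x)%:E|) \+ (fun x => `|(g x)%:E|))%E by apply/funext.
  by apply: integrableD => //; exact: integrable_abse.
pose m (A : set (measurableTypeR R)) := (\int[mu]_(x in A) (`|g x| + `|g x|)%:E)%E.
have m0 : m set0 = 0%E by rewrite /m integral_set0.
have m_ge0 A : (0 <= m A)%E.
  by apply: integral_ge0 => x _; rewrite lee_fin addr_ge0.
have m_add : semi_sigma_additive m.
  apply: semi_sigma_additive_nng_induced; last by move=> x; rewrite lee_fin addr_ge0.
  by have /integrableP[] := m_g setT measurableT.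
pose mm : {measure set (measurableTypeR R) -> \bar R} :=
  HB.pack_for {measure set (measurableTypeR R) -> \bar R} m
    (isMeasure.Build _ _ _ m m0 m_ge0 m_add).
pose nP := lebesgue_stieltjes_measure P; pose nM := lebesgue_stieltjes_measure M.
have P_M A : measurable A -> (nP A + nM A = m A)%E.
  move=> mA; rewrite -measure_addE.
  transitivity (lebesgue_stieltjes_measure D A).
    apply/esym/lebesgue_stieltjes_measure_unique => // _ /ocitvP[->|[[a b]/= /ltW ab ->]].
      by rewrite !measure0.
    rewrite [RHS]measure_addE lsmE//.
    transitivity ((P b - P a)%:E + (M b - M a)%:E)%E.
      by rewrite -EFinD; congr EFin => /=; lra.
    by rewrite -!lsmE.
  apply: (@lebesgue_stieltjes_measure_unique _ _ mm) => // _ /ocitvP[->|[[a b]/= /ltW ab ->]].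
    by rewrite !measure0.
  have igab : mu.-integrable `]a, b] (EFin \o (fun x => `|g x|)).
    by apply: integrableS (integrable_abse ig).
  rewrite lsmE// /m integralD_EFin//= -[(\int[mu]_(_ in _) _)%E]fineK; last first.
    exact: integrable_fin_num.
  rewrite -EFinD; congr EFin; have := norm_primitiveB ig ab.
  rewrite /Rintegral -/G => <-; lra.
have nP_le A : measurable A -> (nP A <= m A)%E.
  by move=> mA; rewrite -P_M// leeDl.
have nP_fin : (nP setT < +oo)%E.
  apply: le_lt_trans (nP_le _ measurableT) _.
  by rewrite ltey_eq integrable_fin_num// m_g.
(* Restricting to the whole space changes no value; it packages [nP] as a finite measure for
   Radon-Nikodym. *)
pose nu := mfrestr measurableT nP_fin.
have nuE A : nu A = nP A by rewrite /nu /mfrestr /mrestr setIT.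
have numu : nu `<< mu.
  apply/null_content_dominatesP => A mA A0; apply/eqP.
  rewrite nuE eq_le measure_ge0 andbT (le_trans (nP_le _ mA))// /m.
  rewrite null_set_integral//.
  by have /integrableP[] := m_g _ mA.
have [w [w0 wfin wint wE]] := radon_nikodym_sigma_finite numu.
(* [w] is the density of G + F and |g| that of G, so the difference is the density of F. *)
pose w' x := fine (w x) - `|g x|.
have w'E A : measurable A -> mu.-integrable A (EFin \o w').
  move=> mA; have -> : EFin \o w' = ((fun x => w x) \- (abse \o (EFin \o g)))%E.
    by apply/funext => x /=; rewrite /w' EFinB fineK.
  apply: integrableB => //; first exact: integrableS wint.
  by apply: integrableS (integrable_abse ig).
exists w'; first exact: w'E.
move=> a b ga gb ab.
rewrite RintegralB//; last 2 first.
- have -> : EFin \o (fun x => fine (w x)) = w by apply/funext => x /=; rewrite fineK.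
  by apply: integrableS wint.
- by apply: integrableS (integrable_abse ig).
rewrite -norm_primitiveB// -/G.
have -> : \int[mu]_(x in `]a, b]) (fine (w x)) = P b - P a.
  rewrite /Rintegral -[RHS]/(fine (P b - P a)%:E) -lsmE//.
  rewrite -[lebesgue_stieltjes_measure P _]/(nP _) -nuE.
  rewrite [nu _]wE//.
  by congr fine; apply: eq_integral => x _; rewrite fineK.
rewrite /= -!(grid_extE cG fG)// -/F; lra.
Qed.

(** * Difference quotients on the grid and Lebesgue differentiation *)

Section dquot.
Context {R : realType}.
Implicit Types (f g w : R -> R) (k : nat) (r t : R).
Local Notation mu := (@lebesgue_measure R).

(* Sign convention: dquot f tends to minus the derivative of f, to match
   I t - I s in transport_eq. *)
Definition dquot f k r : R := \sum_(i < k.+1)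
  \1_(`[i%:R / k.+1%:R, i.+1%:R / k.+1%:R[%classic : set R) r *
  (k.+1%:R * (f (i%:R / k.+1%:R) - f (i.+1%:R / k.+1%:R))).

(* The upper limit makes dlim f r jointly measurable when f depends measurably on
   a parameter, without knowing where the quotients converge. *)
Definition dlim f r : R := fine (limn_esup (fun k => (dquot f k r)%:E)).

(** The sum over indicators makes measurability evident; at r only the summand of the cell
    containing r survives. *)
Lemma dquotE f k r : 0 <= r < 1 ->
  dquot f k r = k.+1%:R * (f (grid_lo k r) - f (grid_hi k r)).
Proof.
move=> /andP[r0 r1].
have fl0 : (0 <= Num.floor (r * k.+1%:R))%R by rewrite floor_ge0 mulr_ge0.
have [i iE] : exists i : nat, Num.floor (r * k.+1%:R) = i%:Z.
  by exists `|Num.floor (r * k.+1%:R)|%N; rewrite gez0_abs.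
have /andP[fl1 fl2] := floor_itv (r * k.+1%:R).
have E1 : (Num.floor (r * k.+1%:R))%:~R = i%:R :> R by rewrite iE -pmulrn.
have E2 : (Num.floor (r * k.+1%:R) + 1)%:~R = i.+1%:R :> R.
  by rewrite intrD E1 natr1.
rewrite E1 in fl1; rewrite E2 in fl2.
have ik : (i < k.+1)%N.
  rewrite -(ltr_nat R); apply: le_lt_trans fl1 _.
  by rewrite gtr_pMl.
rewrite /dquot (bigD1 (Ordinal ik))//= big1 ?addr0.
  rewrite indicE mem_set ?mul1r.
    by rewrite /grid_lo /grid_hi E1 E2.
  rewrite /= in_itv/= ler_pdivrMr// ltr_pdivlMr//.
  by rewrite fl1.
move=> j ji; rewrite indicE memNset ?mul0r//=.
rewrite in_itv/= ler_pdivrMr// ltr_pdivlMr// => /andP[jr rj].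
move/eqP: ji; apply; apply/val_inj => /=.
apply/eqP; rewrite eqn_leq -ltnS -(ltr_nat R) (le_lt_trans jr fl2)/=.
by rewrite -ltnS -(ltr_nat R) (le_lt_trans fl1 rj).
Qed.

Lemma grid_average w : mu.-integrable setT (EFin \o w) ->
  {ae mu, forall r,
    k.+1%:R * \int[mu]_(x in `]grid_lo k r, grid_hi k r]) w x @[k --> \oo] --> w r}.
Proof.
move=> iw.
pose E r k : set R := `]grid_lo k r, grid_hi k r]%classic.
have muE r k : mu (E r k) = (k.+1%:R^-1)%:E.
  rewrite /E lebesgue_measure_itv/= lte_fin (le_lt_trans (grid_lo_le k r) (lt_grid_hi k r)).
  by rewrite -EFinB grid_hiE addrC addKr.
have hE r : nicely_shrinking r (E r).
  split; first by move=> k; exact: measurable_itv.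
  have rho0 k : 0 < 2 * k.+1%:R^-1 :> R by [].
  pose rho k : {posnum R} := PosNum (rho0 k).
  (* The cell lies in the open ball of radius 2/(k+1) around r, whose measure 4/(k+1) is four times
     that of the cell. Radius 1/(k+1) could miss an endpoint of the cell. *)
  exists (4, rho); split => //=.
  - rewrite -[X in _ --> X](mulr0 2); apply: cvgMr; exact: cvg_harmonic.
  - move=> k x; rewrite /E/= in_itv/= /ball/= => /andP[lx xh].
    have := grid_lo_le k r; have := lt_grid_hi k r; rewrite grid_hiE in xh *.
    move: (k.+1%:R^-1) lx xh => h lx xh rh lr; rewrite ltr_norml; lra.
  - move=> k; rewrite lebesgue_measure_ball// muE -EFinM lee_fin.
    by rewrite mulr2n; move: (k.+1%:R^-1) => h; lra.
have liw : locally_integrable setT w.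
  by have := integrable_locally measurableT iw; rewrite patch_setT.
apply: (@filterS _ _ (ae_filter_ringOfSetsType mu) _ _ _
  (lebesgue_differentiation liw)) => r /(nice_lebesgue_differentiation hE liw).
move=> /fine_cvg; apply: cvg_trans; apply: near_eq_cvg; near=> k => /=.
rewrite [mu (E r k)]muE inver invr_eq0 pnatr_eq0/= invrK /Rintegral -[LHS]/(fine _).
rewrite fineM//; apply: integrable_fin_num => //.
  exact: measurable_itv.
by apply: integrableS iw => //; exact: measurable_itv.
Unshelve. all: by end_near. Qed.

End dquot.

Lemma Rintegral_Ioo_patch {R : realType} (g : R -> R) (a b : R) : 0 <= a -> b <= 1 ->
  \int[lebesgue_measure]_(x in `]a, b[) (g \_ `]0, 1[) x =
  \int[lebesgue_measure]_(x in `]a, b[) g x.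
Proof.
move=> a0 b1; apply: eq_Rintegral => x; rewrite inE/= in_itv/= => /andP[ax xb].
by rewrite patchE mem_set//= in_itv/= (le_lt_trans a0 ax) (lt_le_trans xb b1).
Qed.

Section clamp.
Context {R : realType}.
(** Composing with this retraction extends a path on [0,1] by constants to the whole line, where
    [grid_density] works. *)
Definition clamp (t : R) : R := if t <= 0 then 0 else if 1 <= t then 1 else t.

Lemma clamp_itv t : 0 <= clamp t <= 1.
Proof. by rewrite /clamp; case: (leP t 0) => t0; [|case: (leP 1 t) => t1]; lra. Qed.

Lemma le_clamp s t : s <= t -> clamp s <= clamp t.
Proof.
move=> st; rewrite /clamp; case: (leP s 0) => ?; case: (leP t 0) => ?; case: (leP 1 s) => ?;
  by case: (leP 1 t) => ?; lra.
Qed.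

(** The clamped interval lies in the original one. Strictness excludes two points on the same side
    of [0,1], for which this fails. *)
Lemma clamp_lt s t : clamp s < clamp t -> s <= clamp s /\ clamp t <= t.
Proof.
rewrite /clamp; case: (leP s 0) => ?; case: (leP t 0) => ?; case: (leP 1 s) => ?;
  by case: (leP 1 t) => ?; lra.
Qed.

Lemma clamp_id t : 0 <= t <= 1 -> clamp t = t.
Proof. by rewrite /clamp; case: (leP t 0) => t0; [|case: (leP 1 t) => t1]; lra. Qed.

Lemma is_grid0 : is_grid (0 : R).
Proof. by exists 0%N, 0; rewrite mul0r. Qed.

Lemma is_grid1 : is_grid (1 : R).
Proof. by exists 0%N, 1; rewrite divr1. Qed.

Lemma is_grid_clamp t : is_grid t -> is_grid (clamp t).
Proof.
rewrite /clamp; case: leP => _; first by move=> _; exact: is_grid0.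
by case: leP => // _ _; exact: is_grid1.
Qed.
End clamp.

Section grid_increments.
Context {R : realType} (T : set R) (g : R -> R).
Local Notation mu := (@lebesgue_measure R).
Hypothesis T01 : T `<=` `[0, 1].
Hypothesis gridT : forall t : R, is_grid t -> 0 <= t <= 1 -> T t.
Hypothesis ig : mu.-integrable `]0, 1[ (EFin \o g).

(** [grid_density] settles grid times; any other time of [T] is approached by grid times from the
    right, where both f and the primitive of w change little. [T] is kept variable so that two
    arbitrary times can be added to the grid later. *)
Lemma grid_increments (f : R -> R) :
  (forall a b, T a -> T b -> a < b -> `|f a - f b| <= \int[mu]_(x in `]a, b[) g x) ->
  exists w : R -> R, [/\ mu.-integrable setT (EFin \o w),
    {ae mu, forall r, r \in `]0, 1[ -> dquot f k r @[k --> \oo] --> w r} &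
    forall a b, T a -> T b -> a < b -> f a - f b = \int[mu]_(x in `]a, b[) w x].
Proof.
move=> fg.
pose gz := g \_ `]0, 1[.
have igz : mu.-integrable setT (EFin \o gz).
  by rewrite /gz -restrict_EFin; apply/(integrable_mkcond _ _).1.
have intS (h : R -> R) (A : set R) : measurable A -> mu.-integrable setT (EFin \o h) ->
    mu.-integrable A (EFin \o h).
  by move=> mA; exact: integrableS.
have le_gz a b : 0 <= a -> b <= 1 ->
    \int[mu]_(x in `]a, b[) g x <= \int[mu]_(x in `]a, b]) `|gz x|.
  move=> a0 b1; rewrite -(Rintegral_Ioo_patch g a0 b1) -/gz.
  rewrite Rintegral_itv_bndo_bndc; last exact: intS.
  apply: le_Rintegral => //; [exact: intS| |by move=> x _; exact: ler_norm].
  by apply: integrableS (integrable_abse igz).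
(* The minus sign makes [w] the density of decrements, in accordance with [dquot]. *)
have [w iw wE] : exists2 w : R -> R, mu.-integrable setT (EFin \o w) &
    forall a b, is_grid a -> is_grid b -> a <= b ->
      - f (clamp b) - - f (clamp a) = \int[lebesgue_measure]_(x in `]a, b]) w x.
  apply: (grid_density igz) => a b ga gb ab.
  have := le_clamp ab; rewrite le_eqVlt => /predU1P[->|cab].
    by rewrite subrr normr0; exact: Rintegral_ge0.
  have /andP[ca0 _] := clamp_itv a; have /andP[_ cb1] := clamp_itv b.
  rewrite opprK addrC.
  have Tc t : is_grid t -> T (clamp t).
    by move=> gt; apply: gridT; [exact: is_grid_clamp|exact: clamp_itv].
  rewrite (le_trans (fg _ _ (Tc _ ga) (Tc _ gb) cab))//.
  rewrite (le_trans (le_gz _ _ ca0 cb1))//.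
  have [aca cbb] := clamp_lt cab.
  rewrite -!norm_primitiveB ?(ltW cab)// lerB//; exact: le_norm_primitive.
have wE' a b : is_grid a -> is_grid b -> 0 <= a -> b <= 1 -> a <= b ->
    f a - f b = \int[mu]_(x in `]a, b]) w x.
  move=> ga gb a0 b1 ab; rewrite -wE// !clamp_id ?a0 ?b1 ?(le_trans ab)// ?(le_trans a0 ab)//.
  by rewrite opprK addrC.
exists w; split => //.
  apply: (@filterS _ _ (ae_filter_ringOfSetsType mu) _ _ _ (grid_average iw)) => r wr.
  rewrite in_itv/= => /andP[r0 r1]; apply: cvg_trans wr; apply: near_eq_cvg.
  near=> k.
  rewrite dquotE ?r1 ?(ltW r0)//.
  rewrite wE' ?grid_lo_ge0 ?grid_hi_le1 ?(ltW r0)//.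
  - by exists k, (Num.floor (r * k.+1%:R)).
  - exact: is_grid_hi.
  - exact: ltW (le_lt_trans (grid_lo_le _ _) (lt_grid_hi _ _)).
pose Pw t := \int[mu]_(x in `]-oo, t]) w x.
have PwB a b : a <= b -> Pw b - Pw a = \int[mu]_(x in `]a, b]) w x.
  by move=> ab; apply: Rintegral_itvB => //; exact: intS.
have T1 : T 1 by apply: gridT; [exact: is_grid1|rewrite ler01 lexx].
(* In other words f + [Pw] is constant on [T]; the grid point 1 serves as reference. *)
suff fP a : T a -> f a + Pw a = f 1 + Pw 1.
  move=> a b Ta Tb ab; rewrite Rintegral_itv_bndo_bndc; last exact: intS.
  by rewrite -PwB ?(ltW ab)//; have := fP _ Ta; have := fP _ Tb; lra.
move=> Ta; have := T01 Ta; rewrite /= in_itv/= => /andP[a0].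
rewrite le_eqVlt => /predU1P[->//|a1].
have cGg := continuous_norm_primitive igz.
have cGw := continuous_norm_primitive iw.
(* From a to [grid_hi k a], the first term bounds the change of f and the second that of [Pw]. *)
pose H t := norm_primitive gz t + norm_primitive w t.
have cH : H (grid_hi k a) - H a @[k --> \oo] --> 0.
  rewrite -(subrr (H a)); apply: cvgB; last exact: cvg_cst.
  apply: continuous_cvg; last exact: cvg_grid_hi.
  by apply: cvgD; [exact: cGg|exact: cGw].
apply/eqP; rewrite -subr_eq0 -normr_le0.
have c1 : (fun=> `|f a + Pw a - (f 1 + Pw 1)|) @ \oo --> `|f a + Pw a - (f 1 + Pw 1)|.
  exact: cvg_cst.
apply: (ler_cvg_to c1 cH); near=> k.
have ahi := lt_grid_hi k a; have hi1 := grid_hi_le1 k a1.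
have hi0 : 0 <= grid_hi k a by rewrite (le_trans a0)// ltW.
have Thi : T (grid_hi k a).
  by apply: gridT; [exact: is_grid_hi|rewrite hi0 hi1].
have := wE' _ _ (is_grid_hi k a) is_grid1 hi0 (lexx 1) hi1.
rewrite -PwB// => E1.
have := fg _ _ Ta Thi ahi => /le_trans/(_ (le_gz _ _ a0 hi1)).
rewrite -norm_primitiveB ?(ltW ahi)// => E2.
have : `|Pw (grid_hi k a) - Pw a| <= norm_primitive w (grid_hi k a) - norm_primitive w a.
  rewrite PwB ?(ltW ahi)// norm_primitiveB ?(ltW ahi)//.
  by apply: le_normr_Rintegral => //; exact: intS.
move: E2; rewrite /H !ler_norml => /andP[? ?] /andP[? ?]; apply/andP; split; lra.
Unshelve. all: by end_near. Qed.

End grid_increments.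

Section eucl_norm.
Context {R : realType} {C : nat}.
Implicit Types x y : 'rV[R]_C.

Lemma eucl_norm_ge0 x : 0 <= eucl_norm x.
Proof. exact: sqrtr_ge0. Qed.

Lemma le_coord_eucl_norm x j : `|x 0 j| <= eucl_norm x.
Proof.
rewrite -sqrtr_sqr ler_wsqrtr// (bigD1 j)//= lerDl sumr_ge0// => i _.
exact: sqr_ge0.
Qed.

Lemma eucl_normZ (a : R) x : eucl_norm (a *: x) = `|a| * eucl_norm x.
Proof.
rewrite -sqrtr_sqr /eucl_norm -sqrtrM ?sqr_ge0// mulr_sumr; congr Num.sqrt.
by apply: eq_bigr => i _; rewrite mxE exprMn.
Qed.

Lemma eucl_norm_le_sum x : eucl_norm x <= \sum_j `|x 0 j|.
Proof.
rewrite -[leRHS]ger0_norm ?sumr_ge0// -sqrtr_sqr ler_wsqrtr//.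
rewrite expr2 mulr_suml; apply: ler_sum => i _.
rewrite -[leLHS]ger0_norm ?sqr_ge0// normrX expr2 ler_wpM2l// (bigD1 i)//= lerDl sumr_ge0//.
Qed.

Lemma cvg_eucl_norm (u : nat -> 'rV[R]_C) x :
  (forall j, u k 0 j @[k --> \oo] --> x 0 j) ->
  eucl_norm (u k) @[k --> \oo] --> eucl_norm x.
Proof.
move=> ux; rewrite /eucl_norm.
suff H : \sum_i u k 0 i ^+ 2 @[k --> \oo] --> \sum_i x 0 i ^+ 2.
  exact: (cvg_comp _ _ H (@sqrt_continuous _ _)).
elim: (index_enum _) => [|j s IH].
  under eq_fun do rewrite big_nil.
  by rewrite big_nil; exact: cvg_cst.
under eq_fun do rewrite big_cons.
rewrite big_cons; apply: cvgD => //; under eq_fun do rewrite expr2.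
by rewrite expr2; apply: cvgM.
Qed.

End eucl_norm.

(** Measurability of [f] is assumed because almost everywhere equality does not transfer it unless
    the measure is complete. *)
Lemma ae_eq_integrable d (T : measurableType d) (R : realType)
    (mu : {measure set T -> \bar R}) (D : set T) (f g : T -> \bar R) :
  d.-measurable D -> measurable_fun D f -> ae_eq mu D f g -> mu.-integrable D g ->
  mu.-integrable D f.
Proof.
move=> mD mf fg /integrableP[mg gfin]; apply/integrableP; split => //.
rewrite (_ : (\int[mu]_(x in D) `|f x|)%E = (\int[mu]_(x in D) `|g x|)%E)//.
apply: ge0_ae_eq_integral => //; [exact/measurableT_comp..|].
by apply: (@filterS _ _ (ae_filter_ringOfSetsType mu) _ _ _ fg) => x + Dx => /(_ Dx) ->.
Qed.

Section dlim.
Context {R : realType}.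
Implicit Type f : R -> R.
Lemma measurable_dquot f k (D : set R) : measurable_fun D (dquot f k).
Proof.
apply: measurable_sum => i; apply: measurable_funM; last exact: measurable_cst.
exact: measurable_indic.
Qed.

Lemma measurable_dlim f (D : set R) : measurable_fun D (dlim f).
Proof.
apply: measurableT_comp => //; apply: measurable_fun_limn_esup => k.
by apply/measurable_EFinP; exact: measurable_dquot.
Qed.

Lemma dlimE f r l : dquot f k r @[k --> \oo] --> l -> dlim f r = l.
Proof.
move=> fl; have H : (dquot f k r)%:E @[k --> \oo] --> l%:E.
  by apply: cvg_EFin => //; near=> k.
by rewrite /dlim is_cvg_limn_esupE ?(cvg_lim _ H)//; apply/cvg_ex; exists l%:E.
Unshelve. all: by end_near. Qed.
End dlim.

Section vector_increments.
Context {R : realType} {C : nat} (T : set R) (g : R -> R) (f : R -> 'rV[R]_C).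
Local Notation mu := (@lebesgue_measure R).
Hypothesis T01 : T `<=` `[0, 1].
Hypothesis gridT : forall t : R, is_grid t -> 0 <= t <= 1 -> T t.
Hypothesis ig : mu.-integrable `]0, 1[ (EFin \o g).
Hypothesis fg : forall a b, T a -> T b -> a < b ->
  eucl_norm (f a - f b) <= \int[mu]_(x in `]a, b[) g x.

Local Notation f_ j := (fun t => f t 0 j).

Let fj (j : 'I_C) : exists w : R -> R, [/\ mu.-integrable setT (EFin \o w),
    {ae mu, forall r, r \in `]0, 1[ -> dquot (f_ j) k r @[k --> \oo] --> w r} &
    forall a b, T a -> T b -> a < b -> f a 0 j - f b 0 j = \int[mu]_(x in `]a, b[) w x].
Proof.
apply: (grid_increments T01 gridT ig) => a b Ta Tb ab.
apply: le_trans (fg Ta Tb ab).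
by have := le_coord_eucl_norm (f a - f b) j; rewrite !mxE.
Qed.

(** The norm of the vector quotient over a cell is at most the average of g over the same cell, and
    both converge almost everywhere. *)
Lemma dlim_le :
  {ae mu, forall r, r \in `]0, 1[ -> eucl_norm (\row_j dlim (f_ j) r) <= g r}.
Proof.
have igz : mu.-integrable setT (EFin \o (g \_ `]0, 1[)).
  by rewrite -restrict_EFin; apply/(integrable_mkcond _ _).1.
have Hw : {ae mu, forall r, forall j, r \in `]0, 1[ ->
    dquot (f_ j) k r @[k --> \oo] --> dlim (f_ j) r}.
  apply: filter_forall => j; have [w [_ + _]] := fj j.
  apply: (@filterS _ _ (ae_filter_ringOfSetsType mu)) => r + r01.
  by move=> /(_ r01) H; rewrite (dlimE H).
apply: (@filterS2 _ _ (ae_filter_ringOfSetsType mu) _ _ _ _ Hw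
  (grid_average igz)) => r Hr Gr r01.
have D j : (\row_i dquot (f_ i) k r) 0 j @[k --> \oo] --> (\row_i dlim (f_ i) r) 0 j.
  by rewrite mxE; under eq_fun do rewrite mxE; exact: Hr.
have -> : g r = (g \_ `]0, 1[) r by rewrite patchE mem_set.
apply: (ler_cvg_to (cvg_eucl_norm D) Gr); near=> k.
move: r01; rewrite in_itv/= => /andP[r0 r1].
have -> : \row_i dquot (f_ i) k r = k.+1%:R *: (f (grid_lo k r) - f (grid_hi k r)).
  by apply/rowP => j; rewrite !mxE dquotE ?r1 ?(ltW r0).
rewrite eucl_normZ ger0_norm// ler_pM2l//.
have lh := le_lt_trans (grid_lo_le k r) (lt_grid_hi k r).
have lo0 := grid_lo_ge0 k (ltW r0); have hi1 := grid_hi_le1 k r1.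
have := fg _ _ lh; rewrite -Rintegral_itv_bndo_bndc; last first.
  by apply: integrableS igz.
rewrite Rintegral_Ioo_patch//; apply.
  apply: gridT; first by exists k, (Num.floor (r * k.+1%:R)).
  by rewrite lo0 (le_trans (ltW lh)).
by apply: gridT; [exact: is_grid_hi|rewrite hi1 (le_trans lo0 (ltW lh))].
Unshelve. all: by end_near. Qed.

(** The density obtained for [T] equals [dlim] almost everywhere, and [dlim] reads f at grid times
    only; so all choices of [T] share one density. *)
Lemma dlim_density a b : T a -> T b -> a < b ->
  (forall j, mu.-integrable `]a, b[ (fun r => (dlim (f_ j) r)%:E)) /\
  f a - f b = \row_j \int[mu]_(r in `]a, b[) dlim (f_ j) r.
Proof.
move=> Ta Tb ab.
have /andP[a0 _] : 0 <= a <= 1 by have := T01 Ta; rewrite /= in_itv.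
have /andP[_ b1] : 0 <= b <= 1 by have := T01 Tb; rewrite /= in_itv.
have H j : mu.-integrable `]a, b[ (EFin \o dlim (f_ j)) /\
    f a 0 j - f b 0 j = \int[mu]_(r in `]a, b[) dlim (f_ j) r.
  have [w [iw wae ->//]] := fj j.
  have iwab : mu.-integrable `]a, b[ (EFin \o w) by exact: integrableS iw.
  have md : measurable_fun `]a, b[%classic (EFin \o dlim (f_ j)).
    by apply/measurable_EFinP; exact: measurable_dlim.
  have wd : ae_eq mu `]a, b[%classic (EFin \o dlim (f_ j)) (EFin \o w).
    apply: (@filterS _ _ (ae_filter_ringOfSetsType mu) _ _ _ wae) => r wr.
    rewrite /= in_itv/= => /andP[ar rb]; congr EFin; apply: dlimE; apply: wr.
    by rewrite in_itv/= (le_lt_trans a0 ar) (lt_le_trans rb b1).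
  split; first exact: ae_eq_integrable wd iwab.
  congr fine; apply/esym; apply: ae_eq_integral => //.
  by case/integrableP : iwab.
by split=> [j|]; [case: (H j)|apply/rowP => j; rewrite !mxE; case: (H j)].
Qed.

End vector_increments.

(** * Lebesgue null sets in R^n *)

Section cells.
Context {R : realType} {n : nat}.
Implicit Types (k : nat) (x y : 'rV[R]_n) (U : set 'rV[R]_n).

Lemma ball_rVP x (e : R) y : 0 < e -> ball x e y <-> forall i, `|x 0 i - y 0 i| < e.
Proof.
by move=> e0; split=> [[_ H] i|H]; [exact: H|split=> // i j; rewrite ord1; exact: H].
Qed.

Lemma norm_rV_le x (e : R) : 0 <= e -> `|x| <= e <-> forall i, `|x 0 i| <= e.
Proof.
move=> e0; have -> : `|x| = \big[Num.max/0]_ij `|x ij.1 ij.2| by exact: mx_normrE.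
split.
  move=> H i; apply: le_trans H.
  by have := @le_bigmax _ _ _ 0 (fun ij : 'I_1 * 'I_n => `|x ij.1 ij.2|) (0, i).
by move=> H; apply/bigmax_leP; split => // -[i j] _ /=; rewrite ord1.
Qed.

Definition box (a : 'rV[R]_n) (s : R) : set 'rV[R]_n :=
  [set x | forall i, a 0 i <= x 0 i < a 0 i + s].

Definition cell_index k x : {ffun 'I_n -> int} :=
  [ffun i => Num.floor (x 0 i * k.+1%:R)].

Definition cell k (z : {ffun 'I_n -> int}) : set 'rV[R]_n :=
  box (\row_i ((z i)%:~R / k.+1%:R)) k.+1%:R^-1.

Lemma cellP k z x : cell k z x <-> cell_index k x = z.
Proof.
have E i : (z i)%:~R / k.+1%:R <= x 0 i < (z i)%:~R / k.+1%:R + k.+1%:R^-1 <->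
    Num.floor (x 0 i * k.+1%:R) = z i.
  have -> : (z i)%:~R / k.+1%:R + k.+1%:R^-1 = (z i + 1)%:~R / k.+1%:R :> R.
    by rewrite intrD mulrDl mul1r.
  rewrite ler_pdivrMr// ltr_pdivlMr//; split; first by move/floor_def.
  by move=> <-; exact: floor_itv.
split=> [H|zE i].
  by apply/ffunP => i; rewrite ffunE; apply/E; have := H i; rewrite mxE.
by rewrite mxE; apply/E; rewrite -zE ffunE.
Qed.

Lemma cell_diam k z x y : cell k z x -> cell k z y ->
  forall i, `|x 0 i - y 0 i| < k.+1%:R^-1.
Proof.
move=> xz yz i; move: (xz i) (yz i); rewrite mxE.
move: (_ / _) => c; move: (k.+1%:R^-1) => h /andP[? ?] /andP[? ?].
by rewrite ltr_norml; apply/andP; split; lra.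
Qed.

Lemma measurable_box a s : measurable (box a s).
Proof.
have -> : box a s = \bigcap_(i in [set: 'I_n])
    ((fun x : 'rV[R]_n => x 0 i : measurableTypeR R) @^-1` `[a 0 i, a 0 i + s[).
  apply/seteqP; split=> [x H i _/=|x H i]; first by rewrite in_itv/=; exact: H.
  by have := H i I; rewrite /= in_itv.
apply: fin_bigcap_measurable => [|i _]; first exact: finite_finset.
rewrite -[X in measurable X]setTI; exact: measurable_coord_rV.
Qed.

Lemma measurable_cell k z : measurable (cell k z).
Proof. exact: measurable_box. Qed.

Definition inner_cells k U : set 'rV[R]_n :=
  \bigcup_(z in [set z | cell k z `<=` U]) cell k z.

Lemma inner_cells_sub k U : inner_cells k U `<=` U.
Proof. by move=> x [z /= zU xz]; exact: zU. Qed.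

(** The meshes 1/(k+1) are not nested, so [inner_cells k U] need not increase with k; but once the
    mesh is small enough, the cell of x stays in a ball inside U. *)
Lemma inner_cells_near U x : open U -> U x -> \forall k \near \oo, inner_cells k U x.
Proof.
move=> oU Ux; have /nbhs_ballP[e /= e0 eU] : nbhs x U by exact: open_nbhs_nbhs.
near=> k; exists (cell_index k x); last exact/cellP.
move=> y /= yz; apply: eU; apply/ball_rVP => // i.
have xz : cell k (cell_index k x) x by exact/cellP.
apply: lt_le_trans (cell_diam xz yz i) _.
apply: ltW; near: k; exact: (near_infty_natSinv_lt (PosNum e0)).
Unshelve. all: by end_near. Qed.

Lemma measurable_inner_cells k U : measurable (inner_cells k U).
Proof.
rewrite /inner_cells bigcup_mkcond; apply: countable_bigcupT_measurable.
  exact: countableP.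
by move=> z; case: ifPn => _ //; exact: measurable_cell.
Qed.

Lemma open_inner_cells U : open U -> U = \bigcup_k inner_cells k U.
Proof.
move=> oU; apply/seteqP; split=> [x /(inner_cells_near oU)[k _ /(_ _ (leqnn k)) kU]|x [k _]].
  by exists k.
exact: inner_cells_sub.
Qed.

(** Links the topology to the sigma-algebra of the coordinates: an open set is a countable union of
    cells. *)
Lemma open_measurable_rV U : open U -> measurable U.
Proof.
move=> /open_inner_cells ->; apply: bigcupT_measurable => k.
exact: measurable_inner_cells.
Qed.

Lemma continuous_measurable_rV (D : set 'rV[R]_n) (f : 'rV[R]_n -> R) : open D ->
  {in D, continuous f} -> measurable_fun D f.
Proof.
move=> oD cf; apply: (measurability _ (RGenOInfty.measurableE R)) => _ [_ [a ->] <-].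
apply: open_measurable_rV; rewrite openE => x [Dx fx]; apply: filterI.
  exact: open_nbhs_nbhs.
have : nbhs (f x) `]a, +oo[%classic.
  by apply: open_nbhs_nbhs; split => //; exact: interval_open.
by apply: cf; rewrite inE.
Qed.
End cells.

(** The induction peels off the first coordinate; in dimension 0 the box is the only point, of mass
    1 = s^0. *)
Lemma lebesgue_box {R : realType} n (a : 'rV[R]_n) (s : R) : 0 <= s ->
  lebesgue_rV R n (box a s) = (s ^+ n)%:E.
Proof.
move=> s0; elim: n a => [a|n IH a].
  rewrite /= diracE mem_set// => -[]//.
rewrite /= /cons_measure /pushforward.
have -> : @cons_rV R n @^-1` box a s =
    `[a 0 ord0, a 0 ord0 + s[ `*` box (rsubmx (a : 'rV_(1 + n))) s.
  have E0 (p : measurableTypeR R * 'rV[R]_n) : cons_rV p 0 ord0 = p.1.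
    by have := congr1 fst (cons_rVK p).
  have ES (p : measurableTypeR R * 'rV[R]_n) i : cons_rV p 0 (rshift 1 i) = p.2 0 i.
    by have := congr1 (fun q : _ * 'rV[R]_n => q.2 0 i) (cons_rVK p); rewrite /= mxE.
  apply/seteqP; split=> [p H|p [/= H1 H2] i].
    split; first by rewrite /= in_itv/=; have := H ord0; rewrite E0.
    by move=> i; have := H (rshift 1 i); rewrite ES mxE.
  have [->|[j ->]] : i = ord0 \/ exists j : 'I_n, i = rshift 1 j.
    case: (unliftP ord0 i) => [j ->|->]; last by left.
    by right; exists j; apply/val_inj.
  - by rewrite E0; move: H1; rewrite in_itv.
  - by have := H2 j; rewrite ES mxE.
rewrite product_measure1E//; last exact: measurable_box.
rewrite IH -[X in (_ * X)%E = _]/((s ^+ n)%:E) exprS EFinM; congr (_ * _)%E.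
transitivity (lebesgue_measure (`[a 0 ord0, a 0 ord0 + s[%classic : set R)) => //.
rewrite lebesgue_measure_itv/= lte_fin ltrDl.
move: s0; rewrite le_eqVlt => /predU1P[<-|s0]; first by rewrite ltxx.
by rewrite s0 -EFinB addrC addKr.
Qed.

(** * Outer regularity of finite Borel measures on R^n *)

Section regularity.
Context {R : realType} {n : nat}.
Variable mu : {finite_measure set 'rV[R]_n -> \bar R}.

(* Outer regularity of A and of its complement at once, which makes the class of
   such sets visibly stable under complement. *)
Definition open_separated (A : set 'rV[R]_n) := forall e : R, 0 < e ->
  exists U V, [/\ open U, open V, A `<=` U, ~` A `<=` V & (mu (U `&` V) < e%:E)%E].

Lemma open_separatedC A : open_separated A -> open_separated (~` A).
Proof.
move=> sA e /sA[U [V [oU oV AU AV UV]]]; exists V, U.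
by split => //; rewrite ?setCK// setIC.
Qed.

(** An infinite intersection of the open sets [V i] need not be open, so only the first m are
    intersected. What the first m sets [U i] miss of the union is small by continuity from above, as
    [mu] is finite. *)
Lemma open_separated_bigcup (A : (set 'rV[R]_n)^nat) :
  (forall i, open_separated (A i)) -> open_separated (\bigcup_i A i).
Proof.
move=> sA e e0.
have /choice[U /choice[V UV]] : forall i, exists U V,
    [/\ open U, open V, A i `<=` U, ~` A i `<=` V &
      (mu (U `&` V) < (e / 2 / (2 ^ i.+1)%:R)%:E)%E].
  by move=> i; apply: sA; rewrite !divr_gt0// ltr0n expn_gt0.
have mU i : measurable (U i) by apply: open_measurable_rV; case: (UV i).
have mV i : measurable (V i) by apply: open_measurable_rV; case: (UV i).
pose W := \bigcup_i U i.
have mW : measurable W by exact: bigcupT_measurable.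
pose P m := \bigcup_(i < m) U i.
have mP m : measurable (P m) by exact: bigcup_measurable.
have : mu (W `\` P m) @[m --> \oo] --> mu (\bigcap_m (W `\` P m)).
  apply: nonincreasing_cvg_mu.
  - by rewrite ltey_eq fin_num_measure//; exact: measurableD.
  - by move=> m; exact: measurableD.
  - by apply: bigcapT_measurable => m; exact: measurableD.
  - move=> p q pq; apply/subsetPset => x [Wx Px]; split => // -[i /= ip Ux].
    by apply: Px; exists i => //=; exact: leq_trans pq.
rewrite (_ : \bigcap_m (W `\` P m) = set0); last first.
  rewrite -subset0 => x H; have [[i _ Ux] _] := H 0%N I.
  by have [_] := H i.+1 I; apply; exists i => /=.
rewrite measure0 => /fine_cvgP[_ /cvgrPdist_lt/(_ (e / 2))].
have e20 : 0 < e / 2 by rewrite divr_gt0.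
move=> /(_ e20)[m _ /(_ _ (leqnn m))]; rewrite /= sub0r normrN => Hm.
exists W, (\bigcap_(i < m) V i); split.
- by apply: bigcup_open => i _; case: (UV i).
- rewrite bigcap_mkord; apply: big_ind => [||i _]; [exact: openT|exact: openI|].
  by case: (UV i).
- by move=> x [i _ Ax]; exists i => //; case: (UV i) => _ _ + _ _; exact.
- move=> x Ax i _; case: (UV i) => _ _ _ + _; apply => Aix; apply: Ax.
  by exists i.
have mUV : measurable (\bigcup_i (U i `&` V i)).
  by apply: bigcupT_measurable => i; exact: measurableI.
have mWP : measurable (W `\` P m) by exact: measurableD.
have sub : W `&` \bigcap_(i < m) V i `<=` \bigcup_i (U i `&` V i) `|` (W `\` P m).
  move=> x [Wx Vx]; have [[i /= im Ux]|Px] := pselect (P m x); last by right.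
  by left; exists i => //; split => //; exact: Vx.
have mVm : measurable (\bigcap_(i < m) V i) by exact: bigcap_measurableType.
apply: (@le_lt_trans _ _ (mu (\bigcup_i (U i `&` V i)) + mu (W `\` P m))%E).
  apply: le_trans (measureU2 mu mUV mWP).
  by apply: le_measure sub; rewrite inE; [exact: measurableI|exact: measurableU].
rewrite (splitr e) EFinD lee_ltD//.
- by rewrite fin_num_measure.
- have mI i : measurable (U i `&` V i) by exact: measurableI.
  apply: le_trans (measure_sigma_subadditive _ mI mUV (fun x h => h)) _.
  apply: le_trans (epsilon_trick0 xpredT (ltW e20)).
  by apply: lee_nneseries => [i _ _|i _]; [exact: measure_ge0|apply: ltW; case: (UV i)].
- rewrite -(@fineK _ (mu (W `\` P m))) ?fin_num_measure// lte_fin.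
  exact: le_lt_trans (ler_norm _) Hm.
Qed.

(** The complement is covered by the open half-spaces x_i < c + 1/(m+1), whose overlap with the
    given one decreases to the empty set. *)
Lemma open_separated_halfspace i (c : R) : open_separated [set x : 'rV[R]_n | c < x 0 i].
Proof.
move=> e e0.
have oU d : open [set x : 'rV[R]_n | d < x 0 i].
  have -> : [set x : 'rV[R]_n | d < x 0 i] = (fun x : 'rV[R]_n => x 0 i) @^-1` `]d, +oo[.
    by apply/seteqP; split=> x /=; rewrite in_itv/= andbT.
  apply: open_comp; last exact: interval_open.
  by move=> x _; exact: coord_continuous.
have oV d : open [set x : 'rV[R]_n | x 0 i < d].
  have -> : [set x : 'rV[R]_n | x 0 i < d] = (fun x : 'rV[R]_n => x 0 i) @^-1` `]-oo, d[.
    by apply/seteqP; split=> x /=; rewrite in_itv/=.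
  apply: open_comp; last exact: interval_open.
  by move=> x _; exact: coord_continuous.
pose F m := [set x : 'rV[R]_n | c < x 0 i] `&` [set x | x 0 i < c + m.+1%:R^-1].
have mF m : measurable (F m) by apply: open_measurable_rV; exact: (openI (oU _) (oV _)).
have : mu (F m) @[m --> \oo] --> mu (\bigcap_m F m).
  apply: nonincreasing_cvg_mu => //.
  - by rewrite ltey_eq fin_num_measure.
  - exact: bigcapT_measurable.
  - move=> p q pq; apply/subsetPset => x [/= cx xq]; split => //=.
    by rewrite (lt_le_trans xq)// lerD2l lef_pV2 ?posrE// ler_nat.
rewrite (_ : \bigcap_m F m = set0); last first.
  rewrite -subset0 => x H; have [cx _] := H 0%N I.
  have [m /= Hm] := ltr_add_invr cx.
  by have [_ /=] := H m I; rewrite ltNge (ltW Hm).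
rewrite measure0 => /fine_cvgP[_ /cvgrPdist_lt/(_ _ e0)[m _ /(_ _ (leqnn m))]].
rewrite /= sub0r normrN => Hm.
exists [set x | c < x 0 i], [set x | x 0 i < c + m.+1%:R^-1]; split.
- exact: oU.
- exact: oV.
- by [].
- move=> x /=; case: (ltP c (x 0 i)) => [_ /(_ isT)//|xc _].
  by rewrite (le_lt_trans xc)// ltrDl.
- rewrite -(@fineK _ (mu _)) ?fin_num_measure// ?lte_fin; last exact: mF.
  exact: le_lt_trans (ler_norm _) Hm.
Qed.

Lemma measurable_open_separated : measurable `<=` open_separated.
Proof.
have sT : sigma_algebra setT open_separated.
  split.
  - move=> e e0; exists set0, setT; split; [exact: open0|exact: openT|by []|by []|].
    by rewrite set0I measure0 lte_fin.
  - by move=> A sA; rewrite setTD; exact: open_separatedC.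
  - exact: open_separated_bigcup.
apply: smallest_sub => //; elim/big_ind : _ => //; first by move=> P Q HP HQ B [/HP|/HQ].
move=> i _ _ [B mB <-]; rewrite setTI.
have sB : sigma_algebra setT [set B | open_separated ((fun x : 'rV[R]_n => x 0 i) @^-1` B)].
  have [s0 sC sU] := sT; split => /=; first by rewrite preimage_set0.
  - by move=> D; rewrite !setTD preimage_setC => /sC; rewrite setTD.
  - by move=> D sD; rewrite preimage_bigcup; exact: sU.
have : (@RGenOInfty.G R).-sigma.-measurable B by rewrite -RGenOInfty.measurableE.
apply: (@smallest_sub _ (sigma_algebra setT) _ _ sB) => _ [c ->] /=.
have -> : (fun x : 'rV[R]_n => x 0 i) @^-1` `]c, +oo[ = [set x | c < x 0 i].
  by apply/seteqP; split=> x /=; rewrite in_itv/= andbT.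
exact: open_separated_halfspace.
Qed.

End regularity.

(** * Images of null sets under Lipschitz and differentiable maps *)

Section null_image.
Context {R : realType} {n : nat}.
Local Notation lambda := (lebesgue_rV R n).

(** Outer regularity was shown for finite measures, hence the ball. A point of [U] outside [V] lies
    in [A], so inside the ball [U] exceeds its intersection with [V] by a null set only. *)
Lemma null_open_cover (A : set 'rV[R]_n) (M e : R) : 0 < M -> 0 < e ->
  measurable A -> lambda A = 0%E ->
  exists U, [/\ open U, A `&` ball 0 M `<=` U & (lambda U < e%:E)%E].
Proof.
move=> M0 e0 mA A0.
pose D : set 'rV[R]_n := ball 0 M.
have oD : open D by exact: ball_open.
have mD : measurable D by exact: open_measurable_rV.
have Dfin : (lambda D < +oo)%E.
  apply: (@le_lt_trans _ _ (lambda (box (const_mx (- M)) (2 * M)))).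
    apply: le_measure; rewrite ?inE//; first exact: measurable_box.
    move=> x /(ball_rVP _ _ M0) xM i; have := xM i; rewrite !mxE sub0r normrN ltr_norml.
    by move=> /andP[? ?]; apply/andP; split; lra.
  by rewrite lebesgue_box ?ltry// mulr_ge0// ltW.
pose mu := mfrestr mD Dfin.
have [U [V [oU oV AU AV UV]]] := @measurable_open_separated _ _ mu _ mA _ e0.
exists (U `&` D); split; first exact: openI.
  by move=> x [/AU].
have mU := open_measurable_rV oU; have mV := open_measurable_rV oV.
apply: (@le_lt_trans _ _ (lambda ((U `&` V) `&` D) + lambda A)%E); last first.
  by rewrite A0 adde0; move: UV; rewrite /mu /mfrestr /mrestr.
apply: le_trans (measureU2 _ _ _) => //; last exact: measurableI (measurableI _ _ _ _) _.
apply: le_measure; rewrite ?inE//; first exact: measurableI.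
  by apply: measurableU => //; exact: measurableI (measurableI _ _ _ _) _.
move=> x [Ux Dx]; have [Ax|nAx] := pselect (A x); first by right.
by left; split => //; split => //; exact: AV.
Qed.

(* Cells of one mesh that lie inside U are disjoint, so their images are covered
   by boxes of total volume at most (2k+1)^n times that of U. Every point of B
   lies in such a cell for all fine enough meshes, so the lower limit of the
   covers over the mesh still covers the image. *)
Lemma lipschitz_null_image (B : set 'rV[R]_n) (f : 'rV[R]_n -> 'rV[R]_n) (k : nat) :
  (forall x y d, B x -> B y -> 0 < d -> d <= k.+1%:R^-1 ->
     (forall i, `|x 0 i - y 0 i| <= d) -> forall i, `|f x 0 i - f y 0 i| <= k%:R * d) ->
  (forall e, 0 < e -> exists U, [/\ open U, B `<=` U & (lambda U < e%:E)%E]) ->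
  lambda.-negligible (f @` B).
Proof.
move=> fB Bnull.
have cover e : 0 < e -> exists N, [/\ measurable N, f @` B `<=` N & (lambda N <= e%:E)%E].
  move=> e0.
  (* A closed cube of half-width k d fits into a half-open box of side (2k+1) d; the extra d makes
     up for the missing faces. *)
  pose c : R := 2 * k%:R + 1.
  have c0 : 0 < c by rewrite /c ltr_wpDl// mulr_ge0.
  have [U [oU BU Ue]] : exists U, [/\ open U, B `<=` U & (lambda U < (e / c ^+ n)%:E)%E].
    by apply: Bnull; rewrite divr_gt0// exprn_gt0.
  have mU := open_measurable_rV oU.
  (* The Lipschitz bound compares points of [B], so the cell must contain one, around whose image
     the covering box is placed. *)
  pose good K (z : {ffun 'I_n -> int}) := cell K z `<=` U /\ (B `&` cell K z) !=set0.
  pose pt K z : 'rV[R]_n := get (B `&` cell K z).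
  pose d K : R := K.+1%:R^-1.
  pose img K z : set 'rV[R]_n := if pselect (good K z) is left _ then
    box (f (pt K z) - const_mx (k%:R * d K)) (c * d K) else set0.
  pose src K z : set 'rV[R]_n := if pselect (good K z) is left _ then cell K z else set0.
  (* Integer vectors are enumerated for countable subadditivity; an index that codes none
     contributes the empty set. *)
  pose seq_of (F : {ffun 'I_n -> int} -> set 'rV[R]_n) i :=
    if pickle_inv i is Some z then F z else set0.
  pose W K := \bigcup_i (seq_of (img K) i).
  have mimg K i : measurable (seq_of (img K) i).
    rewrite /seq_of /img; case: pickle_inv => // z; case: pselect => // _.
    exact: measurable_box.
  have msrc K i : measurable (seq_of (src K) i).
    rewrite /seq_of /src; case: pickle_inv => // z; case: pselect => // _.
    exact: measurable_cell.
  have mW K : measurable (W K) by exact: bigcupT_measurable.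
  have d0 K : 0 < d K by rewrite /d.
  have We K : (lambda (W K) <= e%:E)%E.
    apply: le_trans (measure_sigma_subadditive _ (mimg K) (mW K) (fun x h => h)) _.
    have E i : lambda (seq_of (img K) i) = ((c ^+ n)%:E * lambda (seq_of (src K) i))%E.
      rewrite /seq_of /img /src; case: pickle_inv => [z|]; last by rewrite !measure0 mule0.
      case: pselect => [_|_]; last by rewrite !measure0 mule0.
      rewrite !lebesgue_box//; last by rewrite mulr_ge0// ltW.
      by rewrite exprMn EFinM.
    rewrite (eq_eseriesr (fun i _ => E i)).
    rewrite nneseriesZl; last by move=> i _; exact: measure_ge0.
    have triv : trivIset setT (seq_of (src K)).
      move=> i j _ _ [x []]; rewrite /seq_of /src.
      have := @pickle_invK {ffun 'I_n -> int} i; have := @pickle_invK {ffun 'I_n -> int} j.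
      case: pickle_inv => //= z <-; case: pickle_inv => //= z' <-.
      case: pselect => // _; case: pselect => // _.
      by move=> /cellP <- /cellP <-.
    have mbsrc : measurable (\bigcup_i seq_of (src K) i) by exact: bigcupT_measurable.
    have -> : (\sum_(i <oo) lambda (seq_of (src K) i))%E =
        lambda (\bigcup_i seq_of (src K) i).
      apply: cvg_lim => //.
      exact: (@measure_semi_sigma_additive _ _ _ lambda _ (msrc K) triv mbsrc).
    rewrite -lee_pdivlMl ?exprn_gt0// -EFinM mulrC.
    apply: le_trans (ltW Ue).
    apply: le_measure; rewrite ?inE//.
    move=> x [i _]; rewrite /seq_of /src; case: pickle_inv => // z.
    by case: pselect => // -[+ _]; exact.
  have key x : B x -> \forall K \near \oo, W K (f x).
    move=> Bx; near=> K.
    have [z /= zU xz] : inner_cells K U x.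
      by near: K; apply: inner_cells_near => //; exact: BU.
    have gz : good K z by split => //; exists x.
    have [Bpt ptz] : (B `&` cell K z) (pt K z).
      by case: gz => _ [y Hy]; exact: (getI Hy).
    exists (pickle z) => //; rewrite /seq_of pickleK_inv /img; case: pselect => // _ i.
    have := fB x (pt K z) (d K) Bx Bpt (d0 K) _ _ i.
    rewrite !mxE ler_norml => /(_ _ _)/andP[].
    - by rewrite lef_pV2 ?posrE// ler_nat ltnS; near: K; exact: nbhs_infty_ge.
    - by move=> j; apply/ltW; exact: cell_diam xz ptz j.
    - by move=> H1 H2; have := d0 K; rewrite /c => ?; apply/andP; split; lra.
  pose L m := \bigcap_(K in [set K | (m <= K)%N]) W K.
  have mL m : measurable (L m) by exact: bigcap_measurableType.
  have mUL : measurable (\bigcup_m L m) by exact: bigcupT_measurable.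
  exists (\bigcup_m L m); split => //.
  - by move=> _ [x Bx <-]; have [m _ Hm] := key _ Bx; exists m.
  - have ndL : nondecreasing_seq L.
      move=> p q pq; apply/subsetPset => x Lx K /= qK; apply: Lx => /=.
      exact: leq_trans pq qK.
    have H := @nondecreasing_cvg_mu _ _ _ lambda _ mL mUL ndL.
    rewrite -(cvg_lim _ H)//; apply: lime_le; first by apply/cvg_ex; eexists; exact: H.
    near=> m; apply: le_trans (We m).
    by apply: le_measure; rewrite ?inE// => x; apply => /=.
(* Negligibility asks for a single measurable null superset: the intersection of the covers of
   measure at most 1/(l+1). *)
have /choice[N HN] : forall l : nat, exists N, [/\ measurable N, f @` B `<=` N &
    (lambda N <= (l.+1%:R^-1)%:E)%E] by move=> l; exact: cover.
have mN l : measurable (N l) by case: (HN l).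
exists (\bigcap_l N l); split; first exact: bigcapT_measurable.
  apply/eqP; rewrite eq_le measure_ge0 andbT; apply/lee_addgt0Pr => e e0.
  rewrite add0e; have [l] := ltr_add_invr e0; rewrite add0r => le.
  apply: (@le_trans _ _ (l.+1%:R^-1)%:E); last by rewrite lee_fin ltW.
  case: (HN l) => _ _; apply: le_trans.
  by apply: le_measure; rewrite ?inE//; [exact: bigcapT_measurable|exact: bigcap_inf].
by move=> y fy l _; case: (HN l) => _ + _; exact.
Unshelve. all: by end_near. Qed.

End null_image.

Section differentiable_null_image.
Context {R : realType} {n : nat}.
Local Notation lambda := (lebesgue_rV R n).

(** One index gives both the constant k and the scale 1/(k+1). The condition weakens as k grows, so
    countably many values exhaust the points of differentiability. *)
Definition lipschitz_at (k : nat) (f : 'rV[R]_n -> 'rV[R]_n) (x : 'rV[R]_n) :=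
  forall (y : 'rV[R]_n) (d : R), 0 < d -> d <= k.+1%:R^-1 ->
    (forall i, `|x 0 i - y 0 i| <= d) -> forall i, `|f x 0 i - f y 0 i| <= k%:R * d.

Lemma differentiable_lipschitz_at (f : 'rV[R]_n -> 'rV[R]_n) (x : 'rV[R]_n) :
  differentiable f x -> exists k, lipschitz_at k f x.
Proof.
move=> df; have [K K0 HK] := linear_lipschitz (diff_continuous df).
have /eqaddoP/(_ 1 ltr01)/nbhs_ballP[e /= e0 He] := diff_locally df.
have [l] := ltr_add_invr e0; rewrite add0r => le.
(* The first term brings the scale below 1/(l+1) < e, where the remainder is at most the increment;
   the second dominates K + 1. *)
exists (maxn l.+1 (Num.trunc (K + 1)).+1) => y d d0 dk xyd i.
have xy : `|y - x| <= d.
  by apply/norm_rV_le; [exact: ltW|move=> j; rewrite !mxE distrC].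
have {}He : `|f y - f x - 'd f x (y - x)| <= `|y - x|.
  have := He (y - x); rewrite !fctE/= /shift subrK mul1r opprD addrA; apply.
  apply: (@le_ball _ _ _ l.+1%:R^-1); first exact: ltW.
  rewrite -ball_normE/= sub0r normrN.
  apply: (le_lt_trans (le_trans xy dk)).
  by rewrite ltf_pV2 ?posrE// ltr_nat ltnS leq_maxl.
have : `|f y - f x| <= (K + 1) * d.
  rewrite -(subrK ('d f x (y - x)) (f y - f x)) (le_trans (ler_normD _ _))//.
  rewrite addrC mulrDl mul1r lerD ?(le_trans He)//.
  by rewrite (le_trans (HK _))// ler_pM2l.
have Kd0 : 0 <= (K + 1) * d by rewrite mulr_ge0 ?addr_ge0// ltW.
move=> /(norm_rV_le _ Kd0) /(_ i); rewrite !mxE distrC => /le_trans; apply.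
rewrite ler_pM2r// (@le_trans _ _ (Num.trunc (K + 1)).+1%:R)//.
  exact: ltW (truncnS_gt _).
by rewrite ler_nat leq_maxr.
Qed.

Lemma differentiable_null_image (A : set 'rV[R]_n) (f : 'rV[R]_n -> 'rV[R]_n) :
  measurable A -> lambda A = 0%E -> (forall x, A x -> differentiable f x) ->
  lambda.-negligible (f @` A).
Proof.
move=> mA A0 dA.
(* [B k] need not be measurable: the open covers are those of the part of [A] in the ball. *)
pose B k := A `&` ball 0 k.+1%:R `&` [set x | lipschitz_at k f x].
have : lambda.-negligible (\bigcup_k (f @` B k)).
  apply: negligible_bigcup => k; apply: (lipschitz_null_image (k := k)).
    by move=> x y d [_ Bx] _ d0 dk H; exact: Bx.
  move=> e e0; have k0 : 0 < k.+1%:R :> R by [].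
  have [U [oU AU Ue]] := null_open_cover k0 e0 mA A0.
  by exists U; split; [|move=> x [/AU]|].
apply: negligibleS => _ [x Ax <-].
have [k Hk] := differentiable_lipschitz_at (dA _ Ax).
exists (maxn k (Num.trunc `|x|)) => //; exists x => //; split.
  split => //; rewrite -ball_normE/= sub0r normrN.
  by rewrite (lt_le_trans (truncnS_gt _))// ler_nat ltnS leq_maxr.
move=> y d d0 dk xyd i; rewrite (le_trans (Hk y d d0 _ xyd i))//.
  by rewrite (le_trans dk)// lef_pV2 ?posrE// ler_nat ltnS leq_maxl.
by rewrite ler_pM2r// ler_nat leq_maxl.
Qed.

End differentiable_null_image.

(** * Joint measurability of the flow and of its inverse *)

Section caratheodory.
Context {R : realType} {n : nat}.
Variables (J : set (measurableTypeR R)) (Om : set 'rV[R]_n).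
Hypotheses (mJ : measurable J) (oOm : open Om).
Local Notation D := (J `*` Om : set (measurableTypeR R * 'rV[R]_n)).

Lemma measurable_strip : measurable D.
Proof. by apply: measurableX => //; exact: open_measurable_rV. Qed.

Lemma measurable_strip_fst (h : R -> R) : measurable_fun J h ->
  measurable_fun D (fun p => h p.1).
Proof.
move=> mh; apply: (measurable_comp mJ _ mh) => //; last first.
  exact: measurable_funTS measurable_fst.
by move=> _ [[t y] [/= Jt _] <-].
Qed.

Lemma measurable_strip_snd (h : 'rV[R]_n -> R) : measurable_fun Om h ->
  measurable_fun D (fun p => h p.2).
Proof.
move=> mh; apply: (measurable_comp (open_measurable_rV oOm) _ mh) => //; last first.
  exact: measurable_funTS measurable_snd.
by move=> _ [[t y] [/= _ Oy] <-].
Qed.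

(* H is only known along the moving dense sequence xi; this applies both to the
   flow (xi constant, eta i t = Y t (d i)) and to its inverse (the two swapped). *)
Lemma caratheodory_dense (H : R -> 'rV[R]_n -> 'rV[R]_n) (xi eta : nat -> R -> 'rV[R]_n) j :
  (forall i k, measurable_fun J (fun t => xi i t 0 k)) ->
  (forall i k, measurable_fun J (fun t => eta i t 0 k)) ->
  (forall t y, J t -> Om y -> {for y, continuous (H t)}) ->
  (forall i t, J t -> Om (xi i t) /\ H t (xi i t) = eta i t) ->
  (forall t y e, J t -> Om y -> 0 < e -> exists i, forall k, `|xi i t 0 k - y 0 k| < e) ->
  measurable_fun D (fun p : R * 'rV[R]_n => H p.1 p.2 0 j).
Proof.
move=> mxi meta cH xiP xid.
apply: (measurability _ (RGenOInfty.measurableE R)) => _ [_ [a ->] <-].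
(* By continuity and density, H(t, y) > a if and only if, for some l and m, every [xi i t] within
   1/(m+1) of y has a value of at least a + 1/(l+1). [far] and [big] encode this implication for one
   i. *)
pose far i m : set (measurableTypeR R * 'rV[R]_n) :=
  \bigcup_(k in [set: 'I_n]) (D `&`
    (fun p : R * 'rV[R]_n => `|xi i p.1 0 k - p.2 0 k|) @^-1` `[m.+1%:R^-1, +oo[).
pose big i l : set (measurableTypeR R * 'rV[R]_n) :=
  D `&` (fun p : R * 'rV[R]_n => eta i p.1 0 j) @^-1` `[a + l.+1%:R^-1, +oo[.
have -> : D `&` (fun p : R * 'rV[R]_n => H p.1 p.2 0 j) @^-1` `]a, +oo[ =
    \bigcup_l \bigcup_m \bigcap_i (far i m `|` big i l).
  have cHj t y : J t -> Om y -> H t y' 0 j @[y' --> y] --> H t y 0 j.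
    by move=> Jt Oy; exact: (cvg_comp _ _ (cH _ _ Jt Oy) (@coord_continuous _ _ _ 0 j _)).
  apply/seteqP; split => [[t y] [[Jt Oy]]|[t y] [l _ [m _ Hlm]]].
    rewrite /= in_itv/= andbT => aH.
    have [l Hl] := ltr_add_invr aH.
    have near_gt : \forall y' \near y, a + l.+1%:R^-1 < H t y' 0 j.
      exact: (@cvgr_gt _ _ _ _ (fun y' => H t y' 0 j) (H t y 0 j) (@cHj t y Jt Oy) _ Hl).
    move/nbhs_ballP : near_gt => [e /= e0 He].
    have [m] := ltr_add_invr e0; rewrite add0r => me.
    exists l => //; exists m => // i _.
    have [] := pselect (exists k, m.+1%:R^-1 <= `|xi i t 0 k - y 0 k|) => [[k Hk]|nk].
      by left; exists k => //; split => //; rewrite /= in_itv/= andbT.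
    right; split => //; rewrite /= in_itv/= andbT.
    have [Oxi <-] := xiP i t Jt; apply: ltW; apply: He; apply/ball_rVP => // k.
    rewrite distrC; apply: lt_trans me; rewrite ltNge; apply/negP => Hk.
    by apply: nk; exists k.
  have [Jt Oy] : D (t, y).
    by case: (Hlm 0%N I) => [[k _ []]//|[]].
  split => //=; rewrite in_itv/= andbT ltNge; apply/negP => Ha.
  have Hal : H t y 0 j < a + l.+1%:R^-1 by rewrite (le_lt_trans Ha)// ltrDl.
  have near_lt : \forall y' \near y, H t y' 0 j < a + l.+1%:R^-1.
    exact: (@cvgr_lt _ _ _ _ (fun y' => H t y' 0 j) (H t y 0 j) (@cHj t y Jt Oy) _ Hal).
  move/nbhs_ballP : near_lt => [e /= e0 He].
  have e'0 : 0 < Num.min e m.+1%:R^-1 by rewrite lt_min e0/=.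
  have [i Hi] := xid _ _ _ Jt Oy e'0.
  have [[k _ [_ /=]]|[_ /=]] := Hlm i I.
    rewrite in_itv/= andbT leNgt => /negP; apply.
    by have := Hi k; rewrite lt_min => /andP[].
  rewrite in_itv/= andbT leNgt => /negP; apply; have [_ <-] := xiP i t Jt.
  apply: He; apply/ball_rVP => // k; rewrite distrC.
  by have := Hi k; rewrite lt_min => /andP[].
apply: bigcupT_measurable => l; apply: bigcupT_measurable => m.
apply: bigcapT_measurable => i.
apply: measurableU.
  apply: fin_bigcup_measurable => [|k _]; first exact: finite_finset.
  apply: (_ : measurable_fun D _) => //; last exact: measurable_strip.
  apply: measurableT_comp => //; apply: measurable_funB.
    exact: measurable_strip_fst (mxi i k).
  exact: measurable_strip_snd (measurable_funTS (measurable_coord_rV k)).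
apply: (measurable_strip_fst (meta i j)) => //; exact: measurable_strip.
Qed.

End caratheodory.

Lemma dense_rV_seq {R : realType} {n : nat} (Om : set 'rV[R]_n) : open Om -> Om !=set0 ->
  exists d : nat -> 'rV[R]_n, (forall i, Om (d i)) /\
    forall y (e : R), Om y -> 0 < e -> exists i, forall k, `|d i 0 k - y 0 k| < e.
Proof.
move=> oOm [x0 Ox0].
pose c (q : nat * {ffun 'I_n -> int}) : 'rV[R]_n := \row_i ((q.2 i)%:~R / q.1.+1%:R).
exists (fun i => if pickle_inv i is Some q then
  (if pselect (Om (c q)) then c q else x0) else x0).
split => [i|y e Oy e0]; first by case: pickle_inv => // q; case: pselect.
have /nbhs_ballP[d /= d0 dO] : nbhs y Om by exact: open_nbhs_nbhs.
have de0 : 0 < Num.min d e by rewrite lt_min d0.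
have [m] := ltr_add_invr de0; rewrite add0r lt_min => /andP[md me].
have corner : cell m (cell_index m y) (c (m, cell_index m y)).
  by move=> i; rewrite lexx ltrDl/=.
have yc := cell_diam corner (proj2 (@cellP _ _ m _ y) erefl).
exists (pickle (m, cell_index m y)) => k; rewrite pickleK_inv; case: pselect => [? /=|nO].
  exact: lt_trans (yc k) me.
exfalso; apply: nO; apply: dO; apply/ball_rVP => // i.
by rewrite distrC; exact: lt_trans (yc i) md.
Qed.

Section flow.
Context {R : realType} {n : nat} (Om : set 'rV[R]_n) (v Y : R -> 'rV[R]_n -> 'rV[R]_n).
Hypotheses (oOm : open Om) (Om0 : Om !=set0) (Yv : flow_of Om v Y).
Local Notation D := (`]0%R, 1%R[%classic `*` Om : set (measurableTypeR R * 'rV[R]_n)).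

Definition is_flow_inverse (G : R -> 'rV[R]_n -> 'rV[R]_n) :=
  forall t, 0 <= t <= 1 -> forall x, Om x ->
    [/\ Om (Y t x), Om (G t x), G t (Y t x) = x, Y t (G t x) = x &
      differentiable (Y t) x /\ differentiable (G t) x].

(** The inverse is chosen at each time separately, with no control in t; [measurable_inverse_flow]
    recovers joint measurability. *)
Lemma flow_inverse : exists G, is_flow_inverse G.
Proof.
have [_ _ Yd] := Yv.
have /choice[G GP] : forall t, exists g, 0 <= t <= 1 ->
    forall x, Om x -> [/\ Om (Y t x), Om (g x), g (Y t x) = x, Y t (g x) = x &
    differentiable (Y t) x /\ differentiable g x].
  move=> t; have [t01|nt] := pselect (0 <= t <= 1); last by exists id.
  have := Yd t; rewrite in_itv/= => /(_ t01)[g [[_ [J1 [_ H1]]] [_ [J2 [_ H2]]] HO _ Hg]].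
  exists g => _ x Ox; have cx := @subset_closure _ Om _ Ox.
  have [? ?] := HO _ Ox; have [? ?] := Hg _ cx; split => //.
  by split; [case: (H1 x Ox)|case: (H2 x Ox)].
by exists G.
Qed.

Lemma measurable_flow_time x (j : 'I_n) : Om x ->
  measurable_fun (`]0, 1[%classic : set (measurableTypeR R)) (fun t : R => Y t x 0 j).
Proof.
move=> Ox; apply: open_continuous_measurable_fun; first exact: interval_open.
move=> t; rewrite inE/= in_itv/= => /andP[t0 t1].
have [_ /(_ x Ox)[_ ac _] _] := Yv.
apply/cvgrPdist_lt => e e0; have [d d0 Hd] := ac e e0.
have H a b : 0 <= a -> a <= b -> b <= 1 -> b - a < d -> `|Y b x 0 j - Y a x 0 j| < e.
  move=> a0 ab b1 abd.
  have := Hd 1%N (fun=> a) (fun=> b); rewrite !big_ord1 => /(_ _ _ abd) lt_e.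
  have := le_coord_eucl_norm (Y b x - Y a x) j; rewrite !mxE => /le_lt_trans; apply.
  by apply: lt_e => // i k _ _ _; rewrite !ord1.
near=> s.
have s0 : 0 <= s by apply: ltW; near: s; exact: lt_nbhsr.
have s1 : s <= 1 by apply: ltW; near: s; exact: lt_nbhsl.
have ts : `|t - s| < d by near: s; apply/nbhs_ballP; exists d.
move: ts; rewrite ltr_norml => /andP[ts1 ts2].
have [st|/ltW st] := leP s t; first by apply: H => //; lra.
by rewrite distrC; apply: H => //; lra.
Unshelve. all: by end_near. Qed.

Lemma measurable_flow (j : 'I_n) : measurable_fun D (fun p : R * 'rV[R]_n => Y p.1 p.2 0 j).
Proof.
have [d [Od dd]] := dense_rV_seq oOm Om0; have [G GP] := flow_inverse.
have t01 (t : measurableTypeR R) : `]0, 1[%classic t -> 0 <= t <= 1.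
  by rewrite /= in_itv/= => /andP[? ?]; rewrite !ltW.
apply: (@caratheodory_dense _ _ `]0, 1[%classic Om _ oOm Y (fun i _ => d i)
  (fun i t => Y t (d i))).
- exact: measurable_itv.
- by move=> i k; exact: measurable_cst.
- by move=> i k; exact: measurable_flow_time.
- move=> t y Jt Oy; have [_ _ _ _ [+ _]] := GP t (t01 t Jt) y Oy.
  exact: differentiable_continuous.
- by [].
- by move=> t y e _ Oy e0; exact: dd.
Qed.

Lemma measurable_inverse_flow (G : R -> 'rV[R]_n -> 'rV[R]_n) (j : 'I_n) :
  is_flow_inverse G ->
  measurable_fun D (fun p : R * 'rV[R]_n => G p.1 p.2 0 j).
Proof.
move=> GP; have [d [Od dd]] := dense_rV_seq oOm Om0.
have t01 (t : measurableTypeR R) : `]0, 1[%classic t -> 0 <= t <= 1.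
  by rewrite /= in_itv/= => /andP[? ?]; rewrite !ltW.
apply: (@caratheodory_dense _ _ `]0, 1[%classic Om _ oOm G (fun i t => Y t (d i))
  (fun i _ => d i)).
- exact: measurable_itv.
- by move=> i k; exact: measurable_flow_time.
- by move=> i k; exact: measurable_cst.
- move=> t y Jt Oy; have [_ _ _ _ [_ +]] := GP t (t01 t Jt) y Oy.
  exact: differentiable_continuous.
- by move=> i t Jt; have [] := GP t (t01 t Jt) (d i) (Od i).
(* The points Y(t, d_i) are dense because Y(t,.) is onto and continuous at the preimage [G t y] of
   y. *)
- move=> t y e Jt Oy e0.
  have [_ OG _ YG _] := GP t (t01 t Jt) y Oy.
  have [_ _ _ _ [/differentiable_continuous + _]] := GP t (t01 t Jt) (G t y) OG.
  move=> cY; have : nbhs (Y t (G t y)) (ball (Y t (G t y)) e) by exact: nbhsx_ballx.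
  move=> /cY/nbhs_ballP[r /= r0 rY].
  have [i Hi] := dd _ _ OG r0; exists i => k.
  have /(ball_rVP _ _ e0)/(_ k) : ball (Y t (G t y)) e (Y t (d i)).
    by apply: rY; apply/ball_rVP => // l; rewrite distrC.
  by rewrite YG distrC.
Qed.

End flow.

(** * Integrals of vector-valued functions and transport along the flow *)

Lemma measurable_fun_rV_in d (T : measurableType d) (R : realType) (n : nat) (D : set T)
    (f : T -> 'rV[R]_n) : d.-measurable D ->
  (forall i, measurable_fun D (fun t => f t 0 i : measurableTypeR R)) ->
  measurable_fun D f.
Proof.
move=> mD mf; apply: (@measurability _ _ _ _ _ _
  (\big[setU/set0]_(i < n) preimage_set_system setT
     (fun x : 'rV[R]_n => x 0 i : measurableTypeR R) measurable)) => //.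
move=> _ [A + <-]; elim/big_ind : _ => //; first by move=> P Q PA QA [/PA|/QA].
move=> i _ [B mB <-]; rewrite setTI; exact: (mf i).
Qed.

Lemma measurable_fun_pair_in d d1 d2 (T : measurableType d) (T1 : measurableType d1)
    (T2 : measurableType d2) (D : set T) (f : T -> T1) (g : T -> T2) :
  d.-measurable D -> measurable_fun D f -> measurable_fun D g ->
  measurable_fun D (fun x => (f x, g x)).
Proof.
move=> mD mf mg; apply: (@measurability _ _ _ _ _ _
  (preimage_set_system setT fst measurable `|` preimage_set_system setT snd measurable)) => //.
by move=> _ [A [[B mB <-]|[B mB <-]] <-]; rewrite setTI; [exact: mf|exact: mg].
Qed.

Section measurable_density.
Context {R : realType} {n : nat} (Om : set 'rV[R]_n).
Hypothesis oOm : open Om.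
Local Notation J := (`]0%R, 1%R[%classic : set (measurableTypeR R)).
Local Notation D := (J `*` Om : set (measurableTypeR R * 'rV[R]_n)).

(** Each quotient reads [F] at finitely many fixed times, where measurability in x suffices, and
    upper limits preserve measurability. *)
Lemma measurable_dlim_strip (F : R -> 'rV[R]_n -> R) :
  (forall a, 0 <= a <= 1 -> measurable_fun Om (F a)) ->
  measurable_fun D (fun p : R * 'rV[R]_n => dlim (fun t => F t p.2) p.1).
Proof.
move=> mF; have mJ : measurable J by exact: measurable_itv.
apply: measurableT_comp => //; apply: measurable_fun_limn_esup => k.
apply/measurable_EFinP; apply: measurable_sum => i; apply: measurable_funM.
  apply: (measurable_strip_fst mJ
    (h := \1_(`[i%:R / k.+1%:R, i.+1%:R / k.+1%:R[%classic : set R))).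
  by apply: measurable_indic; exact: measurable_itv.
apply: measurable_funM; first exact: measurable_cst.
apply: measurable_funB.
  apply: (measurable_strip_snd oOm (h := F (i%:R / k.+1%:R))); apply: mF.
  by rewrite divr_ge0//= ler_pdivrMr// mul1r ler_nat ltnW.
apply: (measurable_strip_snd oOm (h := F (i.+1%:R / k.+1%:R))); apply: mF.
by rewrite divr_ge0//= ler_pdivrMr// mul1r ler_nat.
Qed.

Lemma measurable_strip_comp (h : R * 'rV[R]_n -> R) (H : R -> 'rV[R]_n -> 'rV[R]_n) :
  measurable_fun D h ->
  (forall j, measurable_fun D (fun p : R * 'rV[R]_n => H p.1 p.2 0 j)) ->
  (forall t x, J t -> Om x -> Om (H t x)) ->
  measurable_fun D (fun p => h (p.1, H p.1 p.2)).
Proof.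
move=> mh mH HO; have mD : measurable D.
  by apply: measurable_strip => //; exact: measurable_itv.
apply: (measurable_comp mD _ mh
  (g := fun p : measurableTypeR R * 'rV[R]_n => (p.1, H p.1 p.2))).
  by move=> _ [[t x] [/= Jt Ox] <-]; split => //=; exact: HO.
apply: measurable_fun_pair_in => //; first exact: measurable_funTS measurable_fst.
exact: measurable_fun_rV_in.
Qed.

Lemma measurable_comp_differentiable (u : 'rV[R]_n -> R) (f : 'rV[R]_n -> 'rV[R]_n) :
  measurable_fun Om u -> (forall x, Om x -> Om (f x) /\ differentiable f x) ->
  measurable_fun Om (fun x => u (f x)).
Proof.
move=> mu fO; have mOm := open_measurable_rV oOm.
apply: (measurable_comp mOm _ mu); first by move=> _ [x Ox <-]; case: (fO x Ox).
apply: measurable_fun_rV_in => // j; apply: continuous_measurable_rV => // x.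
rewrite inE => Ox; have [_ /differentiable_continuous cf] := fO x Ox.
exact: (cvg_comp _ _ cf (@coord_continuous _ _ _ 0 j _)).
Qed.

Lemma measurable_eucl_norm d (T : measurableType d) C (A : set T) (Z : T -> 'rV[R]_C) :
  (forall j, measurable_fun A (fun p => Z p 0 j)) ->
  measurable_fun A (fun p => eucl_norm (Z p)).
Proof.
move=> mZ.
have ms : measurable_fun [set: R] (@Num.sqrt R).
  by apply: continuous_measurable_fun; exact: sqrt_continuous.
have mS : measurable_fun A (fun p => \sum_i Z p 0 i ^+ 2).
  by apply: measurable_sum => j; exact: measurable_funX.
exact: measurableT_comp ms mS.
Qed.

End measurable_density.

(** For nonzero norms, expand the sum of the squares of |b| a_i - |a| b_i and divide by 2 |a|
    |b|. *)
Lemma eucl_cauchy_schwarz {R : realType} {C : nat} (a b : 'rV[R]_C) :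
  \sum_i a 0 i * b 0 i <= eucl_norm a * eucl_norm b.
Proof.
have norm0 (x : 'rV[R]_C) : eucl_norm x = 0 -> forall i, x 0 i = 0.
  by move=> x0 i; apply/eqP; rewrite -normr_le0 -x0 le_coord_eucl_norm.
have [a0|a0] := eqVneq (eucl_norm a) 0.
  by rewrite a0 mul0r big1// => i _; rewrite (norm0 _ a0) mul0r.
have [b0|b0] := eqVneq (eucl_norm b) 0.
  by rewrite b0 mulr0 big1// => i _; rewrite (norm0 _ b0) mulr0.
have sq (x : 'rV[R]_C) : \sum_i x 0 i ^+ 2 = eucl_norm x ^+ 2.
  by rewrite sqr_sqrtr// sumr_ge0// => i _; exact: sqr_ge0.
set A := eucl_norm a in a0 *; set B := eucl_norm b in b0 *.
have AB : 0 < 2 * (A * B) by rewrite !mulr_gt0// lt_def ?a0 ?b0 eucl_norm_ge0.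
have H : 0 <= \sum_i (B * a 0 i - A * b 0 i) ^+ 2 by apply: sumr_ge0 => i _; exact: sqr_ge0.
rewrite -(ler_pM2l AB).
have E : \sum_i (B * a 0 i - A * b 0 i) ^+ 2 =
    B ^+ 2 * (\sum_i a 0 i ^+ 2) + A ^+ 2 * (\sum_i b 0 i ^+ 2) -
    2 * (A * B) * \sum_i a 0 i * b 0 i.
  rewrite !mulr_sumr -big_split/= -sumrB; apply: eq_bigr => i _; ring.
by move: H; rewrite E (sq a) (sq b) -/A -/B; nra.
Qed.

Section eucl_norm_integral.
Context d (T : measurableType d) (R : realType) (mu : {measure set T -> \bar R}).
Context (C : nat) (D : set T) (Z : T -> 'rV[R]_C).
Hypotheses (mD : d.-measurable D)
  (iZ : forall j, mu.-integrable D (fun t => (Z t 0 j)%:E)).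

Lemma integrable_eucl_norm : mu.-integrable D (fun t => (eucl_norm (Z t))%:E).
Proof.
have iS : mu.-integrable D (fun t => \sum_(j < C) `|(Z t 0 j)%:E|)%E.
  by apply: integrable_sum => // j _; exact: (integrable_abse (iZ j)).
apply: le_integrable iS => //.
  apply/measurable_EFinP; apply: measurable_eucl_norm => j.
  by apply/measurable_EFinP; case/integrableP : (iZ j).
move=> t _; rewrite gee0_abs ?lee_fin ?eucl_norm_ge0//.
by rewrite sumEFin gee0_abs ?lee_fin ?sumr_ge0//; exact: eucl_norm_le_sum.
Qed.

(** Pair the integral v of Z with itself: |v|^2 is the integral of the scalar product of v and Z, at
    most |v| times the integral of |Z| by Cauchy-Schwarz. *)
Lemma eucl_norm_Rintegral :
  eucl_norm (\row_j \int[mu]_(t in D) Z t 0 j) <= \int[mu]_(t in D) eucl_norm (Z t).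
Proof.
set v := \row_j _; have [v0|v0] := eqVneq (eucl_norm v) 0.
  by rewrite v0; apply: Rintegral_ge0 => t _; exact: eucl_norm_ge0.
have vpos : 0 < eucl_norm v by rewrite lt_def v0 eucl_norm_ge0.
rewrite -(ler_pM2l vpos) -RintegralZl//; last exact: integrable_eucl_norm.
have -> : eucl_norm v * eucl_norm v = \sum_j v 0 j * \int[mu]_(t in D) Z t 0 j.
  rewrite -expr2 sqr_sqrtr ?sumr_ge0// => [|i _]; last exact: sqr_ge0.
  by apply: eq_bigr => j _; rewrite expr2 {2}mxE.
have iS (s : seq 'I_C) :
    mu.-integrable D (EFin \o (fun t => \sum_(j <- s) v 0 j * Z t 0 j)) /\
    \sum_(j <- s) v 0 j * \int[mu]_(t in D) Z t 0 j =
    \int[mu]_(t in D) \sum_(j <- s) v 0 j * Z t 0 j.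
  elim: s => [|j s [IH1 IH2]].
    split; last first.
      by rewrite big_nil; under eq_Rintegral do rewrite big_nil;
        rewrite Rintegral_cst// mul0r.
    by under eq_fun do rewrite big_nil; exact: integrable0.
  have ij : mu.-integrable D (EFin \o (fun t => v 0 j * Z t 0 j)).
    by have := integrableZl mD (v 0 j) (iZ j).
  split; last first.
    under [RHS]eq_Rintegral do rewrite big_cons.
    by rewrite big_cons IH2 RintegralD// RintegralZl//; exact: iZ.
  have := integrableD mD ij IH1; congr (mu.-integrable D _).
  by apply/funext => t /=; rewrite big_cons.
have [i1 ->] := iS (index_enum _).
apply: le_Rintegral => //; last by move=> t _; exact: eucl_cauchy_schwarz.
exact: (integrableZl mD (eucl_norm v) integrable_eucl_norm).
Qed.

End eucl_norm_integral.

(** * Null sets in products and under the flow *)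

Section product_null.
Context d1 d2 (T1 : measurableType d1) (T2 : measurableType d2) (R : realType).
Variables (m1 : {sigma_finite_measure set T1 -> \bar R})
          (m2 : {sigma_finite_measure set T2 -> \bar R}).

(** The product measure integrates x-sections by definition; uniqueness identifies it with the one
    that integrates y-sections. *)
Lemma product_measure_null_ysection (A : set (T1 * T2)) : measurable A ->
  {ae m2, forall y, m1 (ysection A y) = 0%E} -> (m1 \x m2)%E A = 0%E.
Proof.
move=> mA A0.
have -> : (m1 \x m2)%E A = (m1 \x^ m2)%E A.
  by apply: product_measure_unique => // B C mB mC; exact: product_measure2E.
rewrite /product_measure2 (ae_eq_integral (cst 0%E))//; first exact: integral0.
- exact: measurable_fun_ysection.
- by apply: (@filterS _ _ (ae_filter_ringOfSetsType m2) _ _ _ A0) => y /= ->.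
Qed.

Lemma product_measure_null_xsection (A : set (T1 * T2)) : measurable A ->
  {ae m1, forall x, m2 (xsection A x) = 0%E} <-> (m1 \x m2)%E A = 0%E.
Proof.
move=> mA; have mf := measurable_fun_xsection m2 mA.
rewrite /product_measure1; split => [A0|A0].
  rewrite (ae_eq_integral (cst 0%E))//; first exact: integral0.
  by apply: (@filterS _ _ (ae_filter_ringOfSetsType m1) _ _ _ A0) => x /= ->.
have : (\int[m1]_x `|(m2 \o xsection A) x| = 0)%E.
  by rewrite -[RHS]A0; apply: eq_integral => x _; rewrite gee0_abs.
move=> /(ae_eq_integral_abs m1 measurableT mf).
by apply: filterS => x /(_ I).
Qed.

End product_null.

Section flow_null.
Context {R : realType} {n : nat} (Om : set 'rV[R]_n) (v Y : R -> 'rV[R]_n -> 'rV[R]_n).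
Hypotheses (oOm : open Om) (Om0 : Om !=set0) (Yv : flow_of Om v Y).
Local Notation J := (`]0%R, 1%R[%classic : set (measurableTypeR R)).
Local Notation D := (J `*` Om : set (measurableTypeR R * 'rV[R]_n)).
Local Notation lambda1 := (@lebesgue_measure R).
Local Notation lambda := (lebesgue_rV R n).

Lemma flow_null (N : set (measurableTypeR R * 'rV[R]_n)) : measurable N -> N `<=` D ->
  {ae lambda, forall x, Om x ->
    {ae lambda1, forall r : R, r \in `]0, 1[ -> ~ N (r, Y r x)}} ->
  (lambda1 \x lambda)%E N = 0%E.
Proof.
move=> mN ND Nae.
have mD : measurable D.
  by apply: measurable_strip => //; exact: measurable_itv.
have [G GP] := flow_inverse Yv.
have t01 (t : measurableTypeR R) : J t -> 0 <= t <= 1.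
  by rewrite /= in_itv/= => /andP[? ?]; rewrite !ltW.
pose M : set (measurableTypeR R * 'rV[R]_n) :=
  D `&` (fun p => (p.1, Y p.1 p.2)) @^-1` N.
have mM : measurable M.
  apply: (@measurable_fun_pair_in _ _ _ _ (measurableTypeR R) 'rV[R]_n D fst
    (fun p => Y p.1 p.2)) => //.
    exact: measurable_funTS measurable_fst.
  by apply: measurable_fun_rV_in => // j; exact: (measurable_flow oOm Om0 Yv j).
(* For fixed x in Om the section of [M] consists of the times at which the trajectory of x is in
   [N]. *)
have M0 : (lambda1 \x lambda)%E M = 0%E.
  apply: product_measure_null_ysection => //.
  apply: (@filterS _ _ (ae_filter_ringOfSetsType lambda) _ _ _ Nae) => x Hx.
  apply: measure_negligible; first exact: measurable_ysection.
  have [Ox|nOx] := pselect (Om x); last first.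
    have -> : ysection M x = set0 by rewrite -subset0 => r; rewrite /ysection/= inE => -[[]].
    exact: negligible_set0.
  apply: negligibleS (Hx Ox) => r; rewrite /ysection/= inE => -[[/= Jr _] Nr] H.
  by apply: (H _ Nr).
apply/product_measure_null_xsection => //.
have /product_measure_null_xsection-/(_ mM) := M0.
apply: (@filterS _ _ (ae_filter_ringOfSetsType lambda1)) => r Mr.
apply: measure_negligible; first exact: measurable_xsection.
have [Jr|nJr] := pselect (J r); last first.
  have -> : xsection N r = set0 by rewrite -subset0 => y; rewrite /xsection/= inE => /ND[].
  exact: negligible_set0.
(* [Y r] maps Om onto Om, so the image of the slice of [M] covers the slice of [N]. *)
apply: (@negligibleS _ _ _ _ (Y r @` xsection M r)); last first.
  apply: differentiable_null_image => //; first exact: measurable_xsection.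
  move=> x; rewrite /xsection/= inE => -[[_ Ox] _].
  by have [_ _ _ _ []] := GP r (t01 _ Jr) x Ox.
move=> y; rewrite /xsection/= inE => Ny; have [_ /= Oy] := ND _ Ny.
have [_ OG _ YG _] := GP r (t01 _ Jr) y Oy.
exists (G r y) => //; rewrite /= inE; split => //.
by rewrite /= YG.
Qed.

End flow_null.

(** An enumeration of all grid points, cut down to [0,1] only where it is used. Indices that code
    nothing give 0, itself a grid point. *)
Definition unit_grid {R : realType} (i : nat) : R :=
  if @pickle_inv (nat * int)%type i is Some q then q.2%:~R / q.1.+1%:R else 0.

Lemma unit_gridP {R : realType} (t : R) : is_grid t -> exists i, unit_grid i = t.
Proof.
by move=> [k [z ->]]; exists (pickle (k, z)); rewrite /unit_grid pickleK_inv.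
Qed.

(** * The two implications between (a) and (b) *)

Section transport.
Context {R : realType} {n C : nat} (Om : set 'rV[R]_n).
Context (v Y : R -> 'rV[R]_n -> 'rV[R]_n) (I : R -> 'rV[R]_n -> 'rV[R]_C).
Hypotheses (oOm : open Om) (Om0 : Om !=set0) (Yv : flow_of Om v Y).
Hypothesis mI : forall t, 0 <= t <= 1 -> forall j, measurable_fun Om (fun x => I t x 0 j).
Local Notation lambda1 := (@lebesgue_measure R).
Local Notation lambda := (lebesgue_rV R n).
Local Notation J := (`]0%R, 1%R[%classic : set (measurableTypeR R)).
Local Notation D := (J `*` Om : set (measurableTypeR R * 'rV[R]_n)).

Lemma transport_le_countable (z : R * 'rV[R]_n -> R) (T : nat -> R) :
  transport_le Om Y I z ->
  {ae lambda, forall x, Om x -> forall i j, 0 <= T i -> T i < T j -> T j <= 1 ->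
    lambda1.-integrable `]T i, T j[ (fun r => (z (r, Y r x))%:E) /\
    eucl_norm (I (T i) (Y (T i) x) - I (T j) (Y (T j) x)) <=
      \int[lambda1]_(r in `]T i, T j[) (z (r, Y r x))}.
Proof.
move=> zI.
have H : {ae lambda, forall x, forall i j, Om x -> 0 <= T i -> T i < T j -> T j <= 1 ->
    lambda1.-integrable `]T i, T j[ (fun r => (z (r, Y r x))%:E) /\
    eucl_norm (I (T i) (Y (T i) x) - I (T j) (Y (T j) x)) <=
      \int[lambda1]_(r in `]T i, T j[) (z (r, Y r x))}.
  apply: ae_foralln => i; apply: ae_foralln => j.
  have [[Ti [Tij Tj]]|nT] := pselect (0 <= T i /\ T i < T j /\ T j <= 1).
    apply: (@filterS _ _ (ae_filter_ringOfSetsType lambda) _ _ _ (zI _ _ Ti Tij Tj)).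
    by move=> x Hx Ox _ _ _; exact: Hx.
  by apply: aeW => x _ Ti Tij Tj; exfalso; apply: nT.
apply: (@filterS _ _ (ae_filter_ringOfSetsType lambda) _ _ _ H) => x Hx Ox i j.
exact: Hx.
Qed.

Lemma transport_density (z : R * 'rV[R]_n -> R) : L2_path Om z -> transport_le Om Y I z ->
  exists Z : R * 'rV[R]_n -> 'rV[R]_C,
    [/\ L2_vpath Om Z, transport_eq Om Y I Z &
        {ae (lambda1 \x lambda)%E, forall p : R * 'rV[R]_n,
          p.1 \in `]0, 1[ -> Om p.2 -> eucl_norm (Z p) <= z p}].
Proof.
move=> [mz zfin] zI.
have mD : measurable D.
  by apply: measurable_strip => //; exact: measurable_itv.
have [G GP] := flow_inverse Yv.
have t01 (t : measurableTypeR R) : J t -> 0 <= t <= 1.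
  by rewrite /= in_itv/= => /andP[? ?]; rewrite !ltW.
pose F j (t : R) x := I t (Y t x) 0 j.
pose W (p : R * 'rV[R]_n) : 'rV[R]_C := \row_j dlim (fun t => F j t p.2) p.1.
pose Z p := W (p.1, G p.1 p.2).
have mF j t : 0 <= t <= 1 -> measurable_fun Om (F j t).
  move=> t01'; apply: (measurable_comp_differentiable oOm (mI t01' j)) => x Ox.
  by have [? _ _ _ []] := GP t t01' x Ox.
have mW j : measurable_fun D (fun p => W p 0 j).
  have := measurable_dlim_strip oOm (mF j); apply: eq_measurable_fun => p _.
  by rewrite mxE.
have mZ j : measurable_fun D (fun p => Z p 0 j).
  apply: (measurable_strip_comp oOm (mW j)).
    by move=> k; exact: (measurable_inverse_flow oOm Om0 Yv k GP).
  by move=> t x Jt Ox; have [] := GP t (t01 t Jt) x Ox.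
have ZY r x : J r -> Om x -> Z (r, Y r x) = W (r, x).
  by move=> Jr Ox; rewrite /Z/=; have [_ _ -> ] := GP r (t01 r Jr) x Ox.
(* The exceptional points x depend on (t, s), but [W] does not. The bound by z comes out for every
   pair and is used for (0, 1). *)
have key t s : 0 <= t -> t < s -> s <= 1 -> {ae lambda, forall x, Om x ->
    {ae lambda1, forall r : R, r \in `]0, 1[ -> eucl_norm (W (r, x)) <= z (r, Y r x)} /\
    (forall j, lambda1.-integrable `]t, s[ (fun r => (W (r, x) 0 j)%:E)) /\
    I t (Y t x) - I s (Y s x) = \row_j \int[lambda1]_(r in `]t, s[) W (r, x) 0 j}.
  move=> t0 ts s1.
  (* The null set of the hypothesis depends on the pair of times, so only countably
     many times can be handled together: t, s and the grid. *)
  pose T i : R := if i is i'.+1 then if i' is i''.+1 then unit_grid i'' else s else t.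
  have := transport_le_countable T zI.
  apply: (@filterS _ _ (ae_filter_ringOfSetsType lambda)) => x Hx Ox.
  have {}Hx := Hx Ox.
  pose TT : set R := `[0, 1] `&` range T.
  have T01 : TT `<=` `[0, 1] by move=> ? [].
  have gridT (a : R) : is_grid a -> 0 <= a <= 1 -> TT a.
    by move=> /unit_gridP[i <-] a01; split; [rewrite /= in_itv|exists i.+2].
  (* Integrability is stated pair by pair; the pair (0, 1), which the grid contains, gives it on the
     whole interval. *)
  have ig : lambda1.-integrable `]0, 1[ (fun r => (z (r, Y r x))%:E).
    have [i Ei] := unit_gridP (@is_grid0 R); have [j Ej] := unit_gridP (@is_grid1 R).
    by have := Hx i.+2 j.+2; rewrite /= Ei Ej ltr01 !lexx => /(_ isT isT isT)[].
  have fg a b : TT a -> TT b -> a < b -> eucl_norm (I a (Y a x) - I b (Y b x)) <=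
      \int[lambda1]_(r in `]a, b[) z (r, Y r x).
    move=> [+ [i _ Ei]] [+ [j _ Ej]].
    rewrite /= !in_itv/= -Ei -Ej => /andP[a0 _] /andP[_ b1] ab.
    by have [] := Hx i j a0 ab b1.
  split; first exact: (dlim_le T01 gridT ig fg).
  have Tt : TT t by split; [rewrite /= in_itv/= t0 (le_trans (ltW ts))|exists 0%N].
  have Ts : TT s by split; [rewrite /= in_itv/= s1 (le_trans t0 (ltW ts))|exists 1%N].
  have [iW EW] := dlim_density T01 gridT ig fg Tt Ts ts.
  split.
    move=> j; have := iW j; congr (_.-integrable _ _).
    by apply/funext => r; rewrite mxE.
  rewrite EW; apply/rowP => j; rewrite !mxE; apply: eq_Rintegral => r _.
  by rewrite mxE.
pose N : set (measurableTypeR R * 'rV[R]_n) :=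
  D `&` (fun p => eucl_norm (Z p) - z p) @^-1` `]0, +oo[.
have mN : measurable N.
  have : measurable_fun D (fun p => eucl_norm (Z p) - z p).
    by apply: measurable_funB => //; exact: measurable_eucl_norm.
  by move=> mh; exact: (mh mD _ (measurable_itv _)).
have N0 : (lambda1 \x lambda)%E N = 0%E.
  apply: (flow_null oOm Om0 Yv mN); first by move=> p [].
  have := key 0 1 (lexx _) ltr01 (lexx _).
  apply: (@filterS _ _ (ae_filter_ringOfSetsType lambda)) => x Hx Ox.
  have [+ _] := Hx Ox; apply: (@filterS _ _ (ae_filter_ringOfSetsType lambda1)) => r Hr r01.
  have Jr : J r by [].
  move=> [_]; rewrite /= in_itv/= andbT subr_gt0 ZY// => /lt_le_trans-/(_ _ (Hr r01)).
  by rewrite ltxx.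
have Zz : {ae (lambda1 \x lambda)%E, forall p : R * 'rV[R]_n,
    p.1 \in `]0, 1[ -> Om p.2 -> eucl_norm (Z p) <= z p}.
  exists N; split => // p /= /not_implyP[p1 /not_implyP[p2 /negP]].
  by rewrite -ltNge => zZ; split => //=; rewrite in_itv/= andbT subr_gt0.
exists Z; split => //.
  move=> j; split; first exact: mZ.
  apply: le_lt_trans zfin; apply: ae_ge0_le_integral => //.
  - by move=> p _; rewrite lee_fin sqr_ge0.
  - by apply/measurable_EFinP; exact: measurable_funX.
  - by move=> p _; rewrite lee_fin sqr_ge0.
  - by apply/measurable_EFinP; exact: measurable_funX.
  - apply: (@filterS _ _ (ae_filter_ringOfSetsType (lambda1 \x lambda)%E) _ _ _
      Zz) => p Hp [/= p1 p2].
    have {}Hp := Hp p1 p2; rewrite lee_fin -real_normK ?num_real//.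
    rewrite lerXn2r ?nnegrE//; last exact: le_trans (le_coord_eucl_norm _ j) Hp.
    exact: le_trans (eucl_norm_ge0 _) Hp.
move=> t s t0 ts s1; have := key t s t0 ts s1.
apply: (@filterS _ _ (ae_filter_ringOfSetsType lambda)) => x Hx Ox.
have [_ [iW EW]] := Hx Ox.
have Jts r : r \in `]t, s[%classic -> J r.
  by rewrite inE/= !in_itv/= => /andP[tr rs];
    rewrite (le_lt_trans t0 tr) (lt_le_trans rs s1).
split.
  move=> j; have := iW j; apply: eq_integrable => // r /Jts Jr.
  by rewrite ZY.
by rewrite EW; apply/rowP => j; rewrite !mxE; apply: eq_Rintegral => r /Jts Jr; rewrite ZY.
Qed.

Lemma transport_norm (Z : R * 'rV[R]_n -> 'rV[R]_C) :
  L2_vpath Om Z -> transport_eq Om Y I Z ->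
  L2_path Om (fun p => eucl_norm (Z p)) /\ transport_le Om Y I (fun p => eucl_norm (Z p)).
Proof.
move=> Z2 ZI; have mD : measurable D.
  by apply: measurable_strip => //; exact: measurable_itv.
have mZ j : measurable_fun D (fun p => Z p 0 j) by case: (Z2 j).
split.
  split; first exact: measurable_eucl_norm.
  have -> : (\int[(lambda1 \x lambda)%E]_(p in D) ((eucl_norm (Z p)) ^+ 2)%:E =
      \sum_(j < C) \int[(lambda1 \x lambda)%E]_(p in D) ((Z p 0 j) ^+ 2)%:E)%E.
    rewrite -ge0_integral_sum//.
    - apply: eq_integral => p _; rewrite sumEFin sqr_sqrtr// sumr_ge0// => j _.
      exact: sqr_ge0.
    - by move=> j; apply/measurable_EFinP; exact: measurable_funX.
    - by move=> j p _; rewrite lee_fin sqr_ge0.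
  by apply: lte_sum_pinfty => j _; case: (Z2 j).
move=> t s t0 ts s1; have := ZI t s t0 ts s1.
apply: (@filterS _ _ (ae_filter_ringOfSetsType lambda)) => x Hx Ox.
have [iZ ->] := Hx Ox; split; first exact: integrable_eucl_norm.
exact: eucl_norm_Rintegral.
Qed.

End transport.

Unset Implicit Arguments.

Theorem proposition8 (R : realType) (n m C : nat) (Om : set 'rV[R]_n)
    (v Y : R -> 'rV[R]_n -> 'rV[R]_n) (I : R -> 'rV[R]_n -> 'rV[R]_C)
    (n_gt0 : (0 < n)%N) (C_ge1 : (1 <= C)%N)
    (m_gt : 1 + n%:R / 2 < m%:R :> R)
    (domOm : bounded_lipschitz_domain Om)
    (v_L2 : L2_velocity Om m v) (Y_flow : flow_of Om v Y)
    (I_path : image_path Om I) :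
  (forall z : R * 'rV[R]_n -> R,
     L2_path Om z -> transport_le Om Y I z ->
     exists Z : R * 'rV[R]_n -> 'rV[R]_C,
       [/\ L2_vpath Om Z, transport_eq Om Y I Z &
           {ae (@lebesgue_measure R \x lebesgue_rV R n)%E,
             forall p : R * 'rV[R]_n,
             p.1 \in `]0, 1[ -> Om p.2 -> eucl_norm (Z p) <= z p}]) /\
  (forall Z : R * 'rV[R]_n -> 'rV[R]_C,
     L2_vpath Om Z -> transport_eq Om Y I Z ->
     exists z : R * 'rV[R]_n -> R,
       [/\ L2_path Om z, transport_le Om Y I z &
           forall p, p.1 \in `]0, 1[ -> Om p.2 -> z p = eucl_norm (Z p)]).
Proof.
have [Om0 oOm _ _ _] := domOm.
have mI t : 0 <= t <= 1 -> forall j, measurable_fun Om (fun x => I t x 0 j).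
  by move=> t01 j; case: I_path => /(_ t) + _; rewrite in_itv/= => /(_ t01 j)[].
split=> [z z2 zI|Z Z2 ZI].
  exact: (transport_density oOm Om0 Y_flow mI z2 zI).
have [? ?] := transport_norm oOm Z2 ZI.
by exists (fun p => eucl_norm (Z p)).
Qed.
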